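(* Let $\delta\in(0,\overline\delta)$, $f\in L^q(\Omega)$ and $\kappa\in\mathbb{A}_\delta$. The problem $$\inf_{\sigma\in\mathbb{Q}_\delta(f)}\hat I_\delta(\kappa;\sigma),\qquad \hat I_\delta(\kappa;\sigma)=\frac1q\int_{\Omega_\delta}\int_{\Omega_\delta}\kappa^{1-q}(x,x')|\sigma(x,x')|^q\,dx\,dx',$$ admits a unique optimal solution $\sigma^*\in\mathbb{Q}_\delta(f)$. Furthermore, there is a unique Lagrange multiplier $u^*\in L^p(\Omega)$ such that the pair $(\sigma^*,u^* )$ satisfies the first order necessary and sufficient optimality conditions $$\int_{\Omega_\delta}\int_{\Omega_\delta}\kappa^{1-q}(x,x')|\sigma^*(x,x')|^{q-2}\sigma^*(x,x')\tau(x,x')\,dx\,dx'-\int_\Omega\mathcal{D}_\delta\tau(x)\,u^*(x)\,dx=0\quad\forall\tau\in\mathbb{Q}_\delta,\qquad \mathcal{D}_\delta\sigma^*=f.$$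
   Context: Fix an integer $n\ge 2$, exponents $1<p<\infty$ and $q$ with $1/p+1/q=1$, and a connected bounded open Lipschitz domain $\Omega\subset\mathbb{R}^n$. Kernels. For $\delta>0$ let $\Omega_\delta=\bigcup_{x\in\Omega}B(x,\delta)$, and let $\omega_\delta:\mathbb{R}^n\to[0,\infty)$ be a radial kernel supported in $B(0,\delta)$ with $\int_{\mathbb{R}^n}|x|^p\omega_\delta^p(x)\,dx=K_{p,n}^{-1}$, where $K_{p,n}=|\mathbb{S}^{n-1}|^{-1}\int_{\mathbb{S}^{n-1}}|e\cdot s|^p\,ds$ ($e\in\mathbb{S}^{n-1}$ arbitrary). Nonlocal gradient. Functions are extended by zero outside their explicit domain of definition. For $u\in L^p(\Omega)$ put $\mathcal{G}_\delta u(x,x')=[u(x)-u(x')]\omega_\delta(x-x')$, and $\mathbb{U}_{\delta,0}=\{u\in L^p(\Omega):\mathcal{G}_\delta u\in L^p(\Omega_\delta\times\Omega_\delta)\}$, which is dense in $L^p(\Omega)$. There are constants $\overline{\delta}>0$, $C>0$ with $\|u\|_{L^p(\Omega)}\le C\|\mathcal{G}_\delta u\|_{L^p(\Omega_\delta\times\Omega_\delta)}$ for all $u\in\mathbb{U}_{\delta,0}$, $\delta\in(0,\overline\delta)$ (known nonlocal Poincaré inequality). Nonlocal divergence. $\mathcal{D}_\delta:\mathbb{Q}_\delta=D(\mathcal{D}_\delta)\subset L^q(\Omega_\delta\times\Omega_\delta)\to L^q(\Omega)$ is the negative adjoint of $\mathcal{G}_\delta$: $\sigma\in\mathbb{Q}_\delta$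 iff there is $g=:\mathcal{D}_\delta\sigma\in L^q(\Omega)$ with $\int_\Omega g u\,dx=-\int_{\Omega_\delta}\int_{\Omega_\delta}\sigma\,\mathcal{G}_\delta u\,dx\,dx'$ for all $u\in\mathbb{U}_{\delta,0}$. Put $\mathbb{Q}_\delta(f)=\{\sigma\in\mathbb{Q}_\delta:\mathcal{D}_\delta\sigma=f\}$. Conductivities. $\mathbb{A}_\delta\subset L^\infty(\Omega_\delta\times\Omega_\delta)$ is a nonempty, convex, weakly$^*$ compact set such that every $\kappa\in\mathbb{A}_\delta$ satisfies $\underline\kappa\le\kappa(x,x')\le\overline\kappa$ and $\kappa(x,x')=\kappa(x',x)$ for a.e. $(x,x')$, with fixed constants $0<\underline\kappa\le\overline\kappa<\infty$. ''Necessary and sufficient'' means that a $\sigma^*$ is optimal if and only if a $u^*\in L^p(\Omega)$ exists for which the displayed conditions hold. *)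

(* Defs.v *)
From HB Require Import structures.
From mathcomp Require Import all_boot all_order all_algebra.
From mathcomp Require Import all_classical all_reals all_analysis.
From mathcomp Require Import measurable_realfun.
Import Order.TTheory GRing.Theory Num.Theory.
Import numFieldNormedType.Exports.

Set Implicit Arguments.
Unset Strict Implicit.
Unset Printing Implicit Defensive.

Local Open Scope classical_set_scope.
Local Open Scope ring_scope.

Definition measure_rV_display : measure_display -> measure_display.
Proof. exact. Qed.

(* ['rV[T]_n] carries the product sigma-algebra, i.e. the one generated by the
   coordinates; for a realType this is the Borel sigma-algebra. *)
Section measurable_rV.
Context {d} {T : sigmaRingType d} (n : nat).

Let coord : 'I_n -> 'rV[T]_n -> T := fun i x => x ord0 i.

Let rV_set0 : g_sigma_preimage coord set0.
Proof. exact: sigma_algebra0. Qed.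

Let rV_setC A : g_sigma_preimage coord A -> g_sigma_preimage coord (~` A).
Proof. exact: sigma_algebraC. Qed.

Let rV_bigcup (F : _^nat) : (forall i, g_sigma_preimage coord (F i)) ->
  g_sigma_preimage coord (\bigcup_i (F i)).
Proof. exact: sigma_algebra_bigcup. Qed.

HB.instance Definition _ := @isMeasurable.Build (measure_rV_display d)
  'rV[T]_n (g_sigma_preimage coord) rV_set0 rV_setC rV_bigcup.
End measurable_rV.

Lemma measurable_coord (R : realType) n (i : 'I_n) :
  measurable_fun [set: 'rV[R]_n] (fun x => x ord0 i).
Proof.
move=> _ Y mY; rewrite setTI; apply: sub_sigma_algebra => /=.
by rewrite -bigcup_seq/=; exists i; [rewrite /= mem_index_enum|exists Y; rewrite ?setTI].
Qed.

Lemma measurable_fun_rVP d (T : measurableType d) (R : realType) n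
    (f : T -> 'rV[R]_n) :
  (forall i, measurable_fun setT (fun x => f x ord0 i)) ->
  measurable_fun setT f.
Proof.
move=> mf; pose c := fun i (x : 'rV[R]_n) => x ord0 i.
have fS : g_sigma_preimage (fun i => c i \o f) `<=` measurable.
  apply: smallest_sub; first exact: sigma_algebra_measurable.
  by rewrite -bigcup_seq => A [i _ [B mB <-]]; exact: mf.
by rewrite g_sigma_preimage_comp in fS => _ A mA; apply: fS; exists A.
Qed.

Lemma product_sigma_finite d1 d2 (T1 : measurableType d1)
    (T2 : measurableType d2) (R : realType)
    (m1 : {sigma_finite_measure set T1 -> \bar R})
    (m2 : {sigma_finite_measure set T2 -> \bar R}) :
  sigma_finite setT (m1 \x m2)%E.
Proof.
have /sigma_finiteP[F [TF ndF Foo]] := measure_function.sigma_finiteT m1.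
have /sigma_finiteP[G [TG ndG Goo]] := measure_function.sigma_finiteT m2.
exists (fun k => F k `*` G k) => [|k].
  rewrite -setXTT TF TG; apply/seteqP; split=> [[x y] /= [[i _ Fx] [j _ Gy]]|].
    exists (maxn i j) => //; split.
      by move: x Fx; exact/subsetPset/ndF/leq_maxl.
    by move: y Gy; exact/subsetPset/ndG/leq_maxr.
  by move=> [x y] [k _ [/= Fx Gy]]; split; exists k.
have [[mF Fy] [mG Gy]] := (Foo k, Goo k); split; first exact: measurableX.
by rewrite product_measure1E// lte_mul_pinfty// ge0_fin_numE.
Qed.

Section lebesgue_rV.
Context {R : realType}.

Definition cons_rV n (p : measurableTypeR R * 'rV[R]_n) : 'rV[R]_n.+1 :=
  \row_i oapp (fun j => p.2 ord0 j) p.1 (unlift ord0 i).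

Lemma measurable_cons_rV n : measurable_fun setT (@cons_rV n).
Proof.
apply: measurable_fun_rVP => i.
under eq_fun do rewrite mxE.
case: unliftP => [j _|_] /=.
  by exact: (measurableT_comp (@measurable_coord R n j) measurable_snd).
by move=> _ Y mY; exact: (@measurable_fst _ _ (measurableTypeR R) 'rV[R]_n).
Qed.

Section step.
Variables (n : nat) (mu : {sigma_finite_measure set 'rV[R]_n -> \bar R}).

Definition lebesgue_rVS : set 'rV[R]_n.+1 -> \bar R :=
  pushforward (@lebesgue_measure R \x mu)%E (@cons_rV n).

Let lebesgue_rVS0 : (lebesgue_rVS set0 = 0)%E.
Proof. by rewrite /lebesgue_rVS /pushforward preimage_set0 measure0. Qed.

Let mpre A : measurable A -> measurable (@cons_rV n @^-1` A).
Proof. by move=> mA; rewrite -[X in measurable X]setTI; exact: measurable_cons_rV. Qed.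

Let lebesgue_rVS_ge0 A : (0 <= lebesgue_rVS A)%E.
Proof. by rewrite /lebesgue_rVS /pushforward measure_ge0. Qed.

Let lebesgue_rVS_sigma_additive : semi_sigma_additive lebesgue_rVS.
Proof.
move=> F mF tF mUF; rewrite /lebesgue_rVS /pushforward preimage_bigcup.
apply: measure_semi_sigma_additive.
- by move=> k; exact: mpre.
- apply/trivIsetP => i j _ _ ij; rewrite -preimage_setI.
  by move/trivIsetP : tF => /(_ _ _ _ _ ij) ->//; rewrite preimage_set0.
- by rewrite -preimage_bigcup; exact: mpre.
Qed.

HB.instance Definition _ := isMeasure.Build _ _ _ lebesgue_rVS
  lebesgue_rVS0 lebesgue_rVS_ge0 lebesgue_rVS_sigma_additive.

Let uncons (x : 'rV[R]_n.+1) : measurableTypeR R * 'rV[R]_n :=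
  (x ord0 ord0, \row_j x ord0 (lift ord0 j)).

Let measurable_uncons : measurable_fun setT uncons.
Proof.
apply: measurable_fun_pair; first exact: measurable_coord.
apply: measurable_fun_rVP => i.
by under eq_fun do rewrite mxE; exact: measurable_coord.
Qed.

Let cons_rVK : cancel (@cons_rV n) uncons.
Proof.
move=> [t y]; rewrite /uncons /cons_rV; congr pair.
  by rewrite mxE unlift_none.
by apply/rowP => j; rewrite !mxE liftK.
Qed.

Let lebesgue_rVS_sigma_finite : sigma_finite setT lebesgue_rVS.
Proof.
have [F UF F_fin] := product_sigma_finite (@lebesgue_measure R) mu.
exists (fun k => uncons @^-1` F k).
  by rewrite -preimage_bigcup -UF preimage_setT.
move=> k; have [mFk Fky] := F_fin k; split.
  by rewrite -[X in measurable X]setTI; exact: measurable_uncons.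
rewrite /lebesgue_rVS /pushforward -comp_preimage.
by rewrite (_ : uncons \o _ = id)//; apply/funext => z; exact: cons_rVK.
Qed.

HB.instance Definition _ := Measure_isSigmaFinite.Build _ _ _ lebesgue_rVS
  lebesgue_rVS_sigma_finite.

End step.

(* Lebesgue measure on R^n, the n-fold product of [lebesgue_measure]. *)
Fixpoint lebesgue_rV n : {sigma_finite_measure set 'rV[R]_n -> \bar R} :=
  if n is n'.+1 then lebesgue_rVS (lebesgue_rV n') else dirac (0 : 'rV[R]_0).

Definition lebesgue_rV2 n : {measure set ('rV[R]_n * 'rV[R]_n) -> \bar R} :=
  (lebesgue_rV n \x lebesgue_rV n)%E.

End lebesgue_rV.
Arguments lebesgue_rV {R} n.
Arguments lebesgue_rV2 {R} n.


Section euclidean.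
Context {R : realType} {n : nat}.
Implicit Types x y e : 'rV[R]_n.

Definition dot x y : R := \sum_i x ord0 i * y ord0 i.

(* The library norm [`|x|] on ['rV[R]_n] is the sup norm. *)
Definition enorm x : R := Num.sqrt (dot x x).

Definition eball x (r : R) : set 'rV[R]_n := [set y | enorm (y - x) < r].

Definition sphere : set 'rV[R]_n := [set x | enorm x = 1].

Definition direction x : 'rV[R]_n := (enorm x)^-1 *: x.

Definition punctured_ball : set 'rV[R]_n := [set x | 0 < enorm x <= 1].

Lemma dot_ge0 x : 0 <= dot x x.
Proof. by apply: sumr_ge0 => i _; exact: sqr_ge0. Qed.

Lemma measurable_enorm : measurable_fun setT enorm.
Proof.
rewrite (_ : enorm = fun x => dot x x `^ 2^-1); last first.
  by apply/funext => x; rewrite powR12_sqrt// dot_ge0.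
apply: (@measurableT_comp _ _ _ _ _ _ (@powR R ^~ _)) => //.
rewrite /dot; apply: measurable_sum => i.
by apply: measurable_funM; exact: measurable_coord.
Qed.

Lemma measurable_direction : measurable_fun setT direction.
Proof.
apply: measurable_fun_rVP => i; under eq_fun do rewrite mxE.
apply: measurable_funM; last exact: measurable_coord.
under eq_fun do rewrite -powR_inv1 ?sqrtr_ge0//.
by apply: (@measurableT_comp _ _ _ _ _ _ (@powR R ^~ _)) => //; exact: measurable_enorm.
Qed.

Lemma measurable_punctured_ball : measurable punctured_ball.
Proof.
rewrite [X in measurable X](_ : _ = enorm @^-1` `]0, 1]%classic).
  by rewrite -[X in measurable X]setTI; exact: measurable_enorm.
by apply/seteqP; split => x; rewrite /= in_itv.
Qed.

(* Surface measure on the unit sphere, as the cone measure of polar coordinates: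
   [A |-> n * lebesgue_rV {x | 0 < |x| <= 1, x / |x| \in A}]. *)
Definition surface_measure (A : set 'rV[R]_n) : \bar R :=
  (n%:R%:E * lebesgue_rV n (punctured_ball `&` direction @^-1` A))%E.

Let surface_measure0 : surface_measure set0 = 0%E.
Proof. by rewrite /surface_measure preimage_set0 setI0 measure0 mule0. Qed.

Let surface_measure_ge0 A : (0 <= surface_measure A)%E.
Proof. by rewrite /surface_measure mule_ge0// measure_ge0. Qed.

Let surface_measure_sigma_additive : semi_sigma_additive surface_measure.
Proof.
move=> F mF tF mUF.
have mG A : measurable A -> measurable (punctured_ball `&` direction @^-1` A).
  move=> mA; apply: measurableI; first exact: measurable_punctured_ball.
  by rewrite -[X in measurable X]setTI; exact: measurable_direction.
pose G k := punctured_ball `&` direction @^-1` F k.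
have UG : punctured_ball `&` direction @^-1` (\bigcup_k F k) = \bigcup_k G k.
  by rewrite preimage_bigcup setI_bigcupr.
rewrite /surface_measure UG.
under eq_fun do rewrite -ge0_sume_distrr//.
apply: cvgeZl => //; apply: measure_semi_sigma_additive => [k||].
- exact: mG.
- apply/trivIsetP => i j _ _ ij; rewrite /G setIACA setIid -preimage_setI.
  by move/trivIsetP : tF => /(_ _ _ _ _ ij) ->//; rewrite preimage_set0 setI0.
- by rewrite -UG; exact: mG.
Qed.

HB.instance Definition _ := isMeasure.Build _ _ _ surface_measure
  surface_measure0 surface_measure_ge0 surface_measure_sigma_additive.

(* [K_{p,n}], computed at [e]; by rotation invariance it does not depend on the
   unit vector [e]. *)
Definition sphere_mean (p : R) e : R :=
  (fine (surface_measure sphere))^-1 *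
  \int[surface_measure]_(s in sphere) (`|dot e s| `^ p).

End euclidean.

Section lipschitz_domain.
Context {R : realType} {n : nat}.
Implicit Types Omega : set 'rV[R]_n.

(* Near every boundary point, after an orthogonal change of coordinates [U],
   [Omega] is the strict epigraph, in the direction of the coordinate [k], of a
   Lipschitz function of the other [n.-1] coordinates. *)
Definition lipschitz_boundary Omega :=
  forall x0, (closure Omega `\` interior Omega) x0 ->
  exists (r : R) (U : 'M[R]_n) (k : 'I_n) (g : 'rV[R]_n.-1 -> R),
    [/\ 0 < r, U *m U^T = 1%:M, [lipschitz g y | y in setT] &
        forall x, eball x0 r x ->
          Omega x <-> g (col' k (x *m U)) < (x *m U) ord0 k].

Definition bounded_lipschitz_domain Omega :=
  [/\ open Omega, connected Omega, bounded_set Omega & lipschitz_boundary Omega].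

Definition delta_neighborhood Omega (delta : R) : set 'rV[R]_n :=
  \bigcup_(x in Omega) eball x delta.

End lipschitz_domain.

Section Lp.
Context d (T : measurableType d) (R : realType).
Variable mu : {measure set T -> \bar R}.

(* [L^p(D)], each element being represented by a measurable function on the
   whole space that vanishes outside [D]. *)
Definition Lp_on (D : set T) (p : \bar R) : set (T -> R) :=
  [set u | u \in Lfun mu p /\ forall x, ~ D x -> u x = 0].

Definition pairing (D : set T) (u v : T -> R) : R :=
  \int[mu]_(x in D) (u x * v x).

(* The weak* topology is the initial topology of [L^oo -> R^{L^1}]. *)
Definition weak_star_compact (D : set T) (A : set (T -> R)) :=
  compact (A : set (initial_topology
    (fun k : T -> R => (fun phi : {phi | Lp_on D 1%:E phi} =>
       pairing D k (sval phi)) : {ptws {phi | Lp_on D 1%:E phi} -> R}))).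

End Lp.


Section nonlocal.
Context {R : realType} {n : nat}.
Local Notation X := 'rV[R]_n.
Variables (p q : R) (Omega : set X) (delta : R) (omega : X -> R).

(* The integrals over [Omega_delta x Omega_delta] are taken with respect to the
   product measure. *)
Definition pair_domain : set (X * X) :=
  delta_neighborhood Omega delta `*` delta_neighborhood Omega delta.

Definition Lp_dom (r : \bar R) : set (X -> R) :=
  Lp_on (lebesgue_rV n) Omega r.

Definition Lp_pair (r : \bar R) : set (X * X -> R) :=
  Lp_on (lebesgue_rV2 n) pair_domain r.

Definition nonlocal_grad (u : X -> R) : X * X -> R :=
  (fun z => (u z.1 - u z.2) * omega (z.1 - z.2)) \_ pair_domain.

Definition nonlocal_space : set (X -> R) :=
  [set u | Lp_dom p%:E u /\ Lp_pair p%:E (nonlocal_grad u)].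

(* [is_nonlocal_div sigma g] is the graph of the unbounded operator D_delta:
   [sigma] belongs to its domain Q_delta and [D_delta sigma = g]. Density of
   [nonlocal_space] in L^p(Omega) makes [g] unique up to a null set. *)
Definition is_nonlocal_div (sigma : X * X -> R) (g : X -> R) : Prop :=
  [/\ Lp_pair q%:E sigma, Lp_dom q%:E g &
      forall u, nonlocal_space u ->
        pairing (lebesgue_rV n) Omega g u =
        - pairing (lebesgue_rV2 n) pair_domain sigma (nonlocal_grad u)].

Definition energy (kappa sigma : X * X -> R) : R :=
  q^-1 * \int[lebesgue_rV2 n]_(z in pair_domain)
            (kappa z `^ (1 - q) * `|sigma z| `^ q).

Definition is_optimal (kappa : X * X -> R) (f : X -> R) (sigma : X * X -> R) :=
  is_nonlocal_div sigma f /\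
  forall tau, is_nonlocal_div tau f -> energy kappa sigma <= energy kappa tau.

Definition optimality_conditions (kappa : X * X -> R) (f : X -> R)
    (sigma : X * X -> R) (u : X -> R) : Prop :=
  (forall tau g, is_nonlocal_div tau g ->
     \int[lebesgue_rV2 n]_(z in pair_domain)
       (kappa z `^ (1 - q) * `|sigma z| `^ (q - 2) * sigma z * tau z)
     - pairing (lebesgue_rV n) Omega g u = 0) /\
  is_nonlocal_div sigma f.

(* A radial kernel supported in the ball B(0, delta) with the normalization
   [\int |x|^p omega^p = K_{p,n}^-1], where [e] is the unit vector at which
   K_{p,n} is computed. *)
Definition is_kernel (e : X) : Prop :=
  [/\ measurable_fun setT omega,
      forall x, 0 <= omega x,
      forall x y, enorm x = enorm y -> omega x = omega y,
      forall x, ~ eball 0 delta x -> omega x = 0 &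
      (\int[lebesgue_rV n]_x (enorm x `^ p * omega x `^ p)%:E =
       ((sphere_mean p e)^-1)%:E)%E].

Definition nonlocal_poincare (C : R) : Prop :=
  forall u, nonlocal_space u ->
    (Lnorm (lebesgue_rV n) p%:E (EFin \o u) <=
     C%:E * Lnorm (lebesgue_rV2 n) p%:E (EFin \o nonlocal_grad u))%E.

Definition admissible_conductivities (kmin kmax : R)
    (A : set (X * X -> R)) : Prop :=
  [/\ A `<=` Lp_pair +oo%E, A !=set0,
      convex_set (A : set (convex_lmodType (X * X -> R))),
      weak_star_compact (lebesgue_rV2 n) pair_domain A &
      forall kappa, A kappa ->
        {ae lebesgue_rV2 n, forall z, pair_domain z ->
          kmin <= kappa z <= kmax /\ kappa z = kappa (z.2, z.1)}].

End nonlocal.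

(* Main.v *)
Require Import Defs.
From mathcomp Require Import all_boot all_order all_algebra.
From mathcomp Require Import all_classical all_reals all_analysis.
From mathcomp Require Import measurable_realfun.
From mathcomp Require Import ring lra.
Import Order.TTheory GRing.Theory Num.Theory.
Import numFieldNormedType.Exports.

(** The multiplier is found first: [u] minimises the strictly convex primal
    functional [u |-> 1/p \int kappa |G u|^p - \int f u] over the domain of the
    nonlocal gradient [G], which is coercive by the Poincare inequality.  Uniform
    convexity of [|.|^p] makes minimising sequences Cauchy in [L^p], so no weak
    compactness is needed, and [G] is closed.  The Euler-Lagrange equation says
    that [sigma = - kappa |G u|^(p-2) G u] satisfies [D sigma = f], and then
    [kappa^(1-q) |sigma|^(q-2) sigma = - G u] is the optimality system.
    Strict convexity of [|.|^q] turns that system into a sufficient condition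
    and gives uniqueness of [sigma]; since every element of [L^q(Omega)] is a
    divergence, testing with [|u-v|^(p-2)(u-v)] gives uniqueness of [u]. *)

Set Implicit Arguments.
Unset Strict Implicit.
Unset Printing Implicit Defensive.

Local Open Scope classical_set_scope.
Local Open Scope ring_scope.

(** The dual problem is never minimised directly: that some flux has divergence [f], that an optimal
    one exists, and the multiplier all come from one primal minimiser. Necessity needs no variation
    of the dual energy either: an optimal flux agrees a.e. with the constructed one, and the
    optimality system is insensitive to null sets. The convexity estimate carries a term eps (|a|^p
    + |b|^p) because for p < 2 the midpoint gap behaves like |a - b|^2 near the diagonal a = b (away
    from 0) and cannot control |a - b|^p alone; the energy bound on minimising sequences absorbs
    this term. The minimising sequence is chosen so fast that the gradients, and by Poincare the
    functions, converge a.e. as well as in L^p. This suits closedness, since the nonlocal gradient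
    is a pointwise formula. Lower semicontinuity is replaced by the tangent inequality at the limit.
    That every element of L^q(Omega) is a divergence is the existence result itself with another
    right-hand side, which is why [f] stays arbitrary there. *)

(** * Convexity inequalities for powers of real numbers *)

Section power.
Context {R : realType}.
Implicit Types (p q a b t x y : R).

Lemma conjugate_exponent p q : 1 < p -> p^-1 + q^-1 = 1 ->
  1 < q /\ (p - 1) * q = p.
Proof.
move=> p1 pq; have p0 : p != 0 by rewrite gt_eqF// (lt_trans ltr01).
have qE : q^-1 = (p - 1) / p.
  by rewrite mulrBl divff// mul1r; lra.
have q0 : q = p / (p - 1) by rewrite -[q]invrK qE invf_div.
split; last by rewrite q0 mulrCA divff ?mulr1// subr_eq0 gt_eqF.
by rewrite q0 ltr_pdivlMr ?subr_gt0// mul1r ltrBlDl ltrDr.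
Qed.

(** This is Young's inequality for y and x^(p-1), since (x^(p-1))^q = x^p and 1/q = 1 - 1/p. *)
Lemma powR_tangent_le p x y : 1 < p -> 0 <= x -> 0 <= y ->
  x `^ (p - 1) * (y - x) <= p^-1 * (y `^ p - x `^ p).
Proof.
move=> p1 x0 y0; have p0 : 0 < p by rewrite (lt_trans ltr01).
have [q pq] : {q | p^-1 + q^-1 = 1}.
  by exists (1 - p^-1)^-1; rewrite invrK subrKC.
have [q1 pqE] := conjugate_exponent p1 pq; have q0 := lt_trans ltr01 q1.
have := conjugate_powR y0 (powR_ge0 x (p - 1)) p0 q0 pq.
rewrite -powRrM pqE -(mulr_powRB1 x0 p0); have -> : q^-1 = 1 - p^-1 by lra.
rewrite -subr_ge0 => h; rewrite -subr_ge0 (le_trans h)// le_eqVlt.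
by apply/orP; left; apply/eqP; ring.
Qed.

(** Adding the weak inequalities from x to the midpoint m and from m to y leaves the surplus
    (m^(p-1) - x^(p-1)) (y - m), positive by strict monotonicity of the power. *)
Lemma powR_tangent_lt p x y : 1 < p -> 0 <= x -> 0 <= y -> x != y ->
  x `^ (p - 1) * (y - x) < p^-1 * (y `^ p - x `^ p).
Proof.
move=> p1 x0 y0 xy; pose m := (x + y) / 2.
have m0 : 0 <= m by rewrite divr_ge0// addr_ge0.
have xm := powR_tangent_le p1 x0 m0; have my := powR_tangent_le p1 m0 y0.
suff : 0 < (m `^ (p - 1) - x `^ (p - 1)) * (y - m).
  move=> h; rewrite -subr_gt0.
  have -> : p^-1 * (y `^ p - x `^ p) - x `^ (p - 1) * (y - x) =
      (p^-1 * (m `^ p - x `^ p) - x `^ (p - 1) * (m - x)) +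
      (p^-1 * (y `^ p - m `^ p) - m `^ (p - 1) * (y - m)) +
      (m `^ (p - 1) - x `^ (p - 1)) * (y - m) by ring.
  by rewrite ltr_wpDl// addr_ge0// subr_ge0.
have p10 : 0 < p - 1 by rewrite subr_gt0.
have [xy'|yx|/eqP] := ltgtP x y; last by rewrite (negbTE xy).
- have ym : m < y by rewrite /m; lra.
  have xm' : x < m by rewrite /m; lra.
  by rewrite mulr_gt0 ?subr_gt0//; apply: gt0_ltr_powR.
- have ym : y < m by rewrite /m; lra.
  have xm' : m < x by rewrite /m; lra.
  by rewrite nmulr_rgt0 ?subr_lt0//; apply: gt0_ltr_powR.
Qed.

(* The derivative of [a |-> |a|^p / p]. *)
Definition dpow p a := `|a| `^ (p - 2) * a.

Lemma dpow0 p : dpow p 0 = 0. Proof. by rewrite /dpow mulr0. Qed.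

Lemma dpowMr p a : 1 < p -> dpow p a * a = `|a| `^ p.
Proof.
move=> p1; have [->|a0] := eqVneq a 0.
  by rewrite mulr0 normr0 powR0// gt_eqF// (lt_trans ltr01).
rewrite /dpow -mulrA -expr2 -real_normK ?num_real// -powR_mulrn//.
by rewrite -powRD ?subrK// normr_eq0 a0 implybT.
Qed.

Lemma norm_dpow p a : 1 < p -> `|dpow p a| = `|a| `^ (p - 1).
Proof.
move=> p1; have [->|a0] := eqVneq a 0.
  by rewrite dpow0 normr0 powR0// subr_eq0 gt_eqF.
rewrite /dpow normrM ger0_norm ?powR_ge0// -[X in _ * X]powRr1//.
by rewrite -powRD ?normr_eq0 ?a0 ?implybT//; congr (_ `^ _); ring.
Qed.

Lemma norm_dpow_conjugate p q a : 1 < p -> p^-1 + q^-1 = 1 ->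
  `|dpow p a| `^ q = `|a| `^ p.
Proof.
by move=> p1 pq; rewrite norm_dpow// -powRrM (conjugate_exponent p1 pq).2.
Qed.

(** The duality maps for p and q are inverse to each other, weights included. This converts the
    Euler-Lagrange flux into the optimality system. *)
Lemma dpowK p q k a : 1 < p -> p^-1 + q^-1 = 1 -> 0 < k ->
  k `^ (1 - q) * dpow q (k * dpow p a) = a.
Proof.
move=> p1 pq k0; have [_ pqE] := conjugate_exponent p1 pq.
have [->|a0] := eqVneq a 0; first by rewrite !(dpow0, mulr0).
have na0 : `|a| != 0 by rewrite normr_eq0.
rewrite {1}/dpow normrM (gtr0_norm k0) norm_dpow// powRM ?(ltW k0) ?powR_ge0//.
rewrite /dpow -powRrM.
transitivity ((k `^ (1 - q) * k `^ (q - 2) * k) *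
  (`|a| `^ ((p - 1) * (q - 2)) * `|a| `^ (p - 2)) * a); first by ring.
have -> : k `^ (1 - q) * k `^ (q - 2) * k = 1.
  rewrite -[X in _ * X = _](powRr1 (ltW k0)) -!powRD ?(gt_eqF k0) ?implybT//.
  by rewrite (_ : _ + _ = 0) ?powRr0//; ring.
rewrite -powRD ?na0 ?implybT// (_ : _ + _ = 0) ?powRr0 ?mul1r//.
by rewrite mulrBr pqE; ring.
Qed.

(** If |a| and |b| differ, strictness comes from the inequality for absolute values. Otherwise b =
    -a, the right side is 0 and the left side is -2 |a|^p. *)
Lemma dpow_tangent_lt p a b : 1 < p -> a != b ->
  dpow p a * (b - a) < p^-1 * (`|b| `^ p - `|a| `^ p).
Proof.
move=> p1 ab; have p0 : 0 < p by rewrite (lt_trans ltr01).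
have ab_le : dpow p a * (b - a) <= `|a| `^ (p - 1) * (`|b| - `|a|).
  rewrite !mulrBr dpowMr// [X in _ <= _ - X]mulrC mulr_powRB1// lerD2r.
  by rewrite (le_trans (ler_norm _))// normrM norm_dpow.
have [/eqP nab|nab] := boolP (`|a| == `|b|); last first.
  exact: le_lt_trans ab_le (powR_tangent_lt p1 _ _ nab).
rewrite nab subrr mulr0.
have bE : b = - a.
  move/eqP : nab; rewrite eqr_norm2 (negbTE ab)/= => /eqP ->.
  by rewrite opprK.
have a0 : a != 0 by by apply: contra_neq ab => a0; rewrite bE a0 oppr0.
rewrite bE (_ : _ * _ = - (2 * (dpow p a * a))); last by ring.
by rewrite dpowMr// oppr_lt0 mulr_gt0// powR_gt0// normr_gt0.
Qed.

Lemma dpow_tangent_le p a b : 1 < p ->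
  dpow p a * (b - a) <= p^-1 * (`|b| `^ p - `|a| `^ p).
Proof.
move=> p1; have [->|ab] := eqVneq a b; first by rewrite !subrr !mulr0.
exact/ltW/dpow_tangent_lt.
Qed.

Lemma continuous_powR_gt0 p a : 0 < a -> {for a, continuous (@powR R ^~ p)}.
Proof.
move=> a0; apply: differentiable_continuous; apply/derivable1_diffP.
by apply: derivable_powR; rewrite in_itv/= andbT.
Qed.

Lemma continuous_norm_powR p : 0 < p -> continuous (fun a : R => `|a| `^ p).
Proof.
move=> p0 a; have [->|a0] := eqVneq a 0.
  rewrite /continuous_at normr0 powR0 ?gt_eqF//; apply/cvgr0Pnorm_lt => e e0.
  near=> t; rewrite ger0_norm ?powR_ge0//.
  (* Writing e as (e^(1/p))^p reduces the goal to |t| < e^(1/p). *)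
  rewrite -[ltRHS]powRr1 ?ltW// -(mulVf (lt0r_neq0 p0)) powRrM.
  apply: gt0_ltr_powR; rewrite ?nnegrE ?powR_ge0//.
  near: t; have := @cvgr0_norm_lt _ _ _ (nbhs (0 : R)) _ idfun cvg_id.
  by apply; rewrite powR_gt0.
have na : 0 < `|a| by rewrite normr_gt0.
exact: continuous_cvg (continuous_powR_gt0 na) (@norm_continuous _ _ a).
Unshelve. all: by end_near. Qed.

Lemma continuous_dpow p : 1 < p -> continuous (dpow p).
Proof.
move=> p1 a; have [->|a0] := eqVneq a 0.
  (* For p < 2 the factor |a|^(p-2) is unbounded near 0, so continuity there is read off
     |[dpow p a]| = |a|^(p-1). *)
  rewrite /continuous_at dpow0; apply/norm_cvg0P.
  under eq_fun do rewrite norm_dpow//.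
  have p10 : 0 < p - 1 by rewrite subr_gt0.
  have := @continuous_norm_powR _ p10 0.
  by rewrite /continuous_at normr0 powR0// gt_eqF.
apply: cvgM; last exact: cvg_id.
have na : 0 < `|a| by rewrite normr_gt0.
exact: continuous_cvg (continuous_powR_gt0 na) (@norm_continuous _ _ a).
Qed.

(** Twice the defect in midpoint convexity of |.|^p; for p = 2 it equals (a - b)^2 / 2, as in the
    parallelogram identity. *)
Definition midgap p a b := `|a| `^ p + `|b| `^ p - 2 * `|(a + b) / 2| `^ p.

(** In the sum of the tangent inequalities from the midpoint to a and to b, the linear terms
    cancel. *)
Lemma midgap_gt0 p a b : 1 < p -> a != b -> 0 < midgap p a b.
Proof.
move=> p1 ab; have p0 : 0 < p by rewrite (lt_trans ltr01).
pose m := (a + b) / 2.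
have ma : m != a by apply: contra_neq ab => /esym; rewrite /m; lra.
have mb : m != b by apply: contra_neq ab => /esym; rewrite /m; lra.
have := ltrD (dpow_tangent_lt p1 ma) (dpow_tangent_lt p1 mb).
rewrite -!mulrDr (_ : a - m + (b - m) = 0) ?mulr0; last by rewrite /m; lra.
by rewrite pmulr_rgt0 ?invr_gt0// /midgap -/m => /lt_le_trans; apply; lra.
Qed.

Lemma midgap_ge0 p a b : 1 < p -> 0 <= midgap p a b.
Proof.
move=> p1; have [->|ab] := eqVneq a b; last exact/ltW/midgap_gt0.
by rewrite /midgap (_ : (b + b) / 2 = b) ?mulr_natl ?mulr2n ?subrr//; field.
Qed.

Let midgapZ p a t : midgap p a (a * t) = `|a| `^ p * midgap p 1 t.
Proof.
rewrite /midgap (_ : (a + a * t) / 2 = a * ((1 + t) / 2)); last by field.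
by rewrite !normrM !powRM// normr1 powR1 !mulrDr mulrN mulr1 mulrCA.
Qed.

Lemma powRD_le p a b : 0 < p ->
  `|a + b| `^ p <= 2 `^ p * (`|a| `^ p + `|b| `^ p).
Proof.
move=> p0; wlog ab : a b / `|a| <= `|b|.
  by move=> h; have [/h//|/ltW/h] := leP `|a| `|b|; rewrite addrC [X in _ * X]addrC.
have : `|a + b| `^ p <= (2 * `|b|) `^ p.
  apply: ge0_ler_powR; rewrite ?nnegrE ?mulr_ge0// ?(ltW p0)//.
  by rewrite (le_trans (ler_normD _ _))// mulr_natl mulr2n lerD2r.
rewrite powRM// => /le_trans; apply.
by rewrite ler_wpM2l ?powR_ge0// lerDr powR_ge0.
Qed.

(* By symmetry and homogeneity it suffices to take [a = 1] and [|b| <= 1];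
   away from [b = 1] the continuous function [midgap p 1] has a positive
   minimum. *)
Lemma uniformly_convex_powR p eps : 1 < p -> 0 < eps ->
  exists2 K, 0 < K & forall a b,
    `|a - b| `^ p <= eps * (`|a| `^ p + `|b| `^ p) + K * midgap p a b.
Proof.
move=> p1 e0; have p0 : 0 < p by rewrite (lt_trans ltr01).
(* For t within eta of 1, |1 - t|^p <= eta^p <= eps, so the eps term alone suffices; the cap 1 keeps
   the interval [-1, 1 - eta] nonempty. *)
pose eta := Num.min (eps `^ p^-1) 1.
have eta0 : 0 < eta by rewrite lt_min powR_gt0//= ltr01.
have eta1 : eta <= 1 by rewrite ge_min lexx orbT.
have etap : eta `^ p <= eps.
  have epsE : eps = (eps `^ p^-1) `^ p.
    by rewrite -powRrM mulVf ?gt_eqF// powRr1// ltW.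
  rewrite [leRHS]epsE; apply: (ge0_ler_powR (ltW p0)).
  - by rewrite nnegrE ltW.
  - by rewrite nnegrE powR_ge0.
  - by rewrite /eta ge_min lexx.
have cg : {within `[-1, 1 - eta], continuous (midgap p 1)}.
  apply: continuous_subspaceT => t; apply: cvgB; last first.
    apply: cvgMr; apply: (@continuous_comp _ _ _ (fun t => (1 + t) / 2)
      (fun t => `|t| `^ p)); last exact: continuous_norm_powR.
    by apply: cvgMl; apply: cvgD; [exact: cvg_cst|exact: cvg_id].
  by apply: cvgD; [exact: cvg_cst|exact: continuous_norm_powR].
have le_eta : -1 <= 1 - eta by lra.
have [c cI cmin] := EVT_min le_eta cg.
have g0 : 0 < midgap p 1 c.
  apply: midgap_gt0 => //; apply/eqP => c1.
  by move: cI; rewrite -c1 in_itv/=; lra.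
(* |1 - t|^p is at most 2^p * 2 when |t| <= 1, and [midgap p 1 c] is the minimum of the gap on the
   interval. *)
pose K := 2 `^ p * 2 / midgap p 1 c.
have K0 : 0 < K by rewrite divr_gt0// mulr_gt0// powR_gt0.
have key t : `|t| <= 1 ->
    `|1 - t| `^ p <= eps * (1 + `|t| `^ p) + K * midgap p 1 t.
  move=> t1; have [tI|] := boolP (t \in `[-1, 1 - eta]).
    rewrite ler_wpDl//.
      by rewrite mulr_ge0 ?(ltW e0)// addr_ge0// powR_ge0.
    apply: (@le_trans _ _ (2 `^ p * 2)).
      apply: (le_trans (powRD_le _ _ p0)); rewrite ler_wpM2l ?powR_ge0//.
      rewrite normr1 powR1 normrN (_ : 2 = 1 + 1)// lerD2l.
      by rewrite (le_trans (ge0_ler_powR (ltW p0) _ _ t1)) ?nnegrE// powR1.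
    by rewrite /K -mulrA ler_peMr ?mulr_ge0 ?powR_ge0// mulrC ler_pdivlMr// mul1r cmin.
  rewrite in_itv/= negb_and -!ltNge => tI.
  rewrite ler_wpDr//; first by rewrite mulr_ge0 ?(ltW K0) ?midgap_ge0.
  apply: (@le_trans _ _ (eta `^ p)).
    apply: (ge0_ler_powR (ltW p0)); rewrite ?nnegrE ?(ltW eta0)//.
    move: t1; rewrite ler_norml => /andP[? ?].
    by rewrite ler_norml; case/orP: tI => ?; apply/andP; split; lra.
  by rewrite (le_trans etap)// ler_peMr ?(ltW e0)// lerDl powR_ge0.
exists K => // a b.
wlog ba : a b / `|b| <= `|a|.
  move=> h; have [/h//|/ltW/h] := leP `|b| `|a|.
  by rewrite distrC [`|b| `^ _ + _]addrC /midgap [b + a]addrC [`|b| `^ _ + _]addrC.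
have [a0|a0] := eqVneq a 0.
  move: ba; rewrite a0 normr0 normr_le0 => /eqP ->.
  rewrite subrr normr0 powR0 ?gt_eqF// addr0 mulr0 add0r.
  by rewrite mulr_ge0 ?(ltW K0) ?midgap_ge0.
have bE : b = a * (b / a) by rewrite mulrCA mulfV ?mulr1.
have t1 : `|b / a| <= 1 by rewrite normf_div ler_pdivrMr ?normr_gt0// mul1r.
move: (b / a) bE t1 => t -> t1.
rewrite midgapZ (_ : a - a * t = a * (1 - t)); last by ring.
rewrite !normrM !powRM//; have := ler_wpM2l (powR_ge0 `|a| p) (key _ t1).
by move=> /le_trans; apply; rewrite le_eqVlt; apply/orP; left; apply/eqP; ring.
Qed.

Lemma young_eps p q eta : 1 < p -> p^-1 + q^-1 = 1 -> 0 < eta ->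
  exists2 K, 0 < K & forall a b, `|a * b| <= eta * `|a| `^ p + K * `|b| `^ q.
Proof.
move=> p1 pq eta0; have p0 : 0 < p by rewrite (lt_trans ltr01).
have [q1 _] := conjugate_exponent p1 pq; have q0 := lt_trans ltr01 q1.
(* With this scaling, Young's inequality for s|a| and |b|/s has first term (s|a|)^p / p = eta
   |a|^p. *)
pose s := (p * eta) `^ p^-1; have s0 : 0 < s by rewrite powR_gt0// mulr_gt0.
have sp : s `^ p = p * eta.
  by rewrite -powRrM mulVf ?gt_eqF// powRr1// ltW// mulr_gt0.
exists (s^-1 `^ q / q); first by rewrite divr_gt0// powR_gt0// invr_gt0.
move=> a b; rewrite normrM.
have -> : `|a| * `|b| = (s * `|a|) * (s^-1 * `|b|).
  by rewrite mulrACA divff ?mul1r// gt_eqF.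
have sa : 0 <= s * `|a| by rewrite mulr_ge0// ltW.
have sb : 0 <= s^-1 * `|b| by rewrite mulr_ge0// invr_ge0 ltW.
apply: (le_trans (conjugate_powR sa sb p0 q0 pq)).
rewrite !powRM ?(ltW s0) ?invr_ge0 ?(ltW s0)// sp.
rewrite le_eqVlt; apply/orP; left; apply/eqP.
by rewrite -!mulrA mulrCA [p * _]mulrC; field; rewrite !gt_eqF.
Qed.

End power.

(** * Real-valued integrals and almost-everywhere comparison *)

Section real_integrals.
Context d (T : measurableType d) (R : realType).
Variable mu : {measure set T -> \bar R}.
Implicit Types f g h : T -> R.

Lemma integrable_le f g : measurable_fun setT f ->
  (forall x, `|f x| <= g x) -> mu.-integrable setT (EFin \o g) ->
  mu.-integrable setT (EFin \o f).
Proof.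
move=> mf fg; apply: le_integrable => //; first exact/measurable_EFinP.
by move=> x _; rewrite /= lee_fin (le_trans (fg x))// ler_norm.
Qed.

Lemma integrable_ae_le f g : measurable_fun setT f ->
  {ae mu, forall x, `|f x| <= g x} -> mu.-integrable setT (EFin \o g) ->
  mu.-integrable setT (EFin \o f).
Proof.
move=> mf fg /integrableP[mg goo].
apply/integrableP; split; first exact/measurable_EFinP.
apply: le_lt_trans goo; apply: ae_ge0_le_integral => //.
- by apply: measurableT_comp => //; exact/measurable_EFinP.
- exact: measurableT_comp.
- by apply: filterS fg => x fg _; rewrite /= lee_fin (le_trans fg)// ler_norm.
Qed.

Lemma integrable_measurable f :
  mu.-integrable setT (EFin \o f) -> measurable_fun setT f.
Proof. by case/integrableP => /measurable_EFinP. Qed.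

Lemma integrableDR f g : mu.-integrable setT (EFin \o f) ->
  mu.-integrable setT (EFin \o g) -> mu.-integrable setT (EFin \o (f \+ g)).
Proof. by move=> fi gi; exact: (integrableD measurableT fi gi). Qed.

Lemma integrableBR f g : mu.-integrable setT (EFin \o f) ->
  mu.-integrable setT (EFin \o g) -> mu.-integrable setT (EFin \o (f \- g)).
Proof. by move=> fi gi; exact: (integrableB measurableT fi gi). Qed.

Lemma integrableZR k f : mu.-integrable setT (EFin \o f) ->
  mu.-integrable setT (EFin \o (fun x => k * f x)).
Proof. by move=> fi; exact: (integrableZl measurableT k fi). Qed.

Lemma ae_eq_Rintegral f g : measurable_fun setT f -> measurable_fun setT g ->
  {ae mu, forall x, f x = g x} -> \int[mu]_x f x = \int[mu]_x g x.
Proof.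
move=> mf mg fg; congr fine; apply: ae_eq_integral => //.
- exact/measurable_EFinP.
- exact/measurable_EFinP.
- by apply: filterS fg => x -> _.
Qed.

(** The function min(f, g) equals f a.e. and lies below g everywhere, so the pointwise comparison
    applies to it. *)
Lemma ae_le_Rintegral f g : mu.-integrable setT (EFin \o f) ->
  mu.-integrable setT (EFin \o g) -> {ae mu, forall x, f x <= g x} ->
  \int[mu]_x f x <= \int[mu]_x g x.
Proof.
move=> fi gi fg.
have mf := integrable_measurable fi; have mg := integrable_measurable gi.
have mfg : measurable_fun setT (fun x => Num.min (f x) (g x)).
  exact: measurable_minr.
have fE : {ae mu, forall x, f x = Num.min (f x) (g x)}.
  by apply: filterS fg => x fgx; rewrite min_l.
rewrite (ae_eq_Rintegral mf mfg fE); apply: le_Rintegral => //; last first.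
  by move=> x _; rewrite ge_min lexx orbT.
apply: integrable_ae_le mfg _ (integrable_norm fi).
by apply: filterS fE => x <-; rewrite /= lexx.
Qed.

Lemma le_RintegralT f g : mu.-integrable setT (EFin \o f) ->
  mu.-integrable setT (EFin \o g) -> (forall x, f x <= g x) ->
  \int[mu]_x f x <= \int[mu]_x g x.
Proof. by move=> fi gi fg; exact: le_Rintegral. Qed.

Lemma Rintegral_eq0_ae f : mu.-integrable setT (EFin \o f) ->
  (forall x, 0 <= f x) -> \int[mu]_x f x = 0 -> {ae mu, forall x, f x = 0}.
Proof.
move=> fi f0 If0.
have mf : measurable_fun setT (EFin \o f) by case/integrableP: fi.
have : (\int[mu]_(x in setT) `|(EFin \o f) x| = 0)%E.
  rewrite -[RHS](congr1 EFin If0) /Rintegral fineK.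
    by apply: eq_integral => x _ /=; rewrite ger0_norm.
  exact: integrable_fin_num.
by move/(ae_eq_integral_abs mu measurableT mf); apply: filterS => x /(_ I) [].
Qed.

End real_integrals.

(** * L^p membership through integrability of |u|^p *)

Section power_integrable.
Context d (T : measurableType d) (R : realType).
Variable mu : {measure set T -> \bar R}.
Implicit Types (p q : R) (u v : T -> R).

Lemma measurable_norm_powR p u : measurable_fun setT u ->
  measurable_fun setT (fun x => `|u x| `^ p).
Proof.
move=> mu_; apply: (@measurableT_comp _ _ _ _ _ _ (@powR R ^~ p)) => //.
exact: measurableT_comp.
Qed.

Lemma measurable_dpow p u : measurable_fun setT u ->
  measurable_fun setT (fun x => dpow p (u x)).
Proof. by move=> mu_; apply: measurable_funM => //; exact: measurable_norm_powR. Qed.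

Lemma Lfun_powRP p u : 1 < p -> u \in Lfun mu p%:E <->
  measurable_fun setT u /\
  mu.-integrable setT (EFin \o (fun x => `|u x| `^ p)).
Proof.
move=> p1; split=> [up|[mu_ iu]].
  split; last exact: Lfun_integrable (ltW p1) up.
  by move/sub_Lfun_mfun : up; rewrite inE.
apply/andP; rewrite !inE; split => //=; rewrite /finite_norm unlock /Lnorm.
by apply: poweR_lty; have := integrable_lty measurableT iu.
Qed.

Lemma Lfun_measurable p u : 1 < p -> u \in Lfun mu p%:E -> measurable_fun setT u.
Proof. by move=> p1 /(Lfun_powRP _ p1)[]. Qed.

Lemma Lfun_powR_integrable p u : 1 < p -> u \in Lfun mu p%:E ->
  mu.-integrable setT (EFin \o (fun x => `|u x| `^ p)).
Proof. by move=> p1 /(Lfun_powRP _ p1)[]. Qed.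

Lemma Lfun_le p u v : 1 < p -> measurable_fun setT u -> v \in Lfun mu p%:E ->
  (forall x, `|u x| <= `|v x|) -> u \in Lfun mu p%:E.
Proof.
move=> p1 mu_ /(Lfun_powRP _ p1)[_ iv] uv; apply/Lfun_powRP => //; split => //.
apply: integrable_le iv; first exact: measurable_norm_powR.
move=> x; rewrite ger0_norm ?powR_ge0//.
by apply: ge0_ler_powR; rewrite ?nnegrE// (le_trans ler01)// ltW.
Qed.

Lemma LfunDZ p k u v : 1 < p -> u \in Lfun mu p%:E -> v \in Lfun mu p%:E ->
  (fun x => u x + k * v x) \in Lfun mu p%:E.
Proof.
move=> p1 /(Lfun_powRP _ p1)[mu_ iu] /(Lfun_powRP _ p1)[mv iv]; apply/Lfun_powRP => //.
have muv : measurable_fun setT (fun x => u x + k * v x).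
  by apply: measurable_funD => //; exact: measurable_funM.
split => //.
have := integrableZR (2 `^ p) (integrableDR iu (integrableZR (`|k| `^ p) iv)).
apply: integrable_le; first exact: measurable_norm_powR.
move=> x; rewrite ger0_norm ?powR_ge0//= -powRM// -normrM.
by apply: powRD_le; rewrite (lt_trans ltr01).
Qed.

Lemma LfunB p u v : 1 < p -> u \in Lfun mu p%:E -> v \in Lfun mu p%:E ->
  (fun x => u x - v x) \in Lfun mu p%:E.
Proof.
move=> p1 up vp; have := LfunDZ (-1) p1 up vp.
by under eq_fun do rewrite mulN1r.
Qed.

(** Young's inequality dominates the product by |u|^p + K |v|^q. *)
Lemma integrable_LfunM p q u v : 1 < p -> p^-1 + q^-1 = 1 ->
  u \in Lfun mu p%:E -> v \in Lfun mu q%:E ->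
  mu.-integrable setT (EFin \o (fun x => u x * v x)).
Proof.
move=> p1 pq; have [q1 _] := conjugate_exponent p1 pq.
move=> /(Lfun_powRP _ p1)[mu_ iu] /(Lfun_powRP _ q1)[mv iv].
have [K _ KP] := young_eps p1 pq ltr01.
have := integrableDR iu (integrableZR K iv).
apply: integrable_le; first exact: measurable_funM.
by move=> x; rewrite /= -[X in X + _]mul1r; exact: KP.
Qed.

Lemma Lfun_dpow p q u : 1 < p -> p^-1 + q^-1 = 1 ->
  u \in Lfun mu p%:E -> (fun x => dpow p (u x)) \in Lfun mu q%:E.
Proof.
move=> p1 pq; have [q1 _] := conjugate_exponent p1 pq.
move=> /(Lfun_powRP _ p1)[mu_ iu]; apply/Lfun_powRP => //.
split; first exact: measurable_dpow.
by under eq_fun do rewrite norm_dpow_conjugate//.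
Qed.

End power_integrable.

(** * Strong and a.e. limits of fast Cauchy sequences in L^p *)

Section Lp_completeness.
Context {R : realType}.

(** The steps telescope against the geometric tail 2 r 2^(-k). This explicit rate later dominates
    |u_k - u|. *)
Lemma cvg_geometric_steps (a : nat -> R) (r : R) :
  (forall k, `|a k.+1 - a k| <= r * 2^-1 ^+ k) ->
  exists2 l, a @ \oo --> l & forall k, `|a k - l| <= 2 * r * 2^-1 ^+ k.
Proof.
move=> ar; have := le_trans (normr_ge0 _) (ar 0%N).
rewrite expr0 mulr1 => r0.
have step k j : `|a (k + j)%N - a k| <= 2 * r * (2^-1 ^+ k - 2^-1 ^+ (k + j)).
  elim: j => [|j IHj]; first by rewrite addn0 !subrr normr0 mulr0.
  have -> : a (k + j.+1)%N - a k =
      (a (k + j).+1 - a (k + j)%N) + (a (k + j)%N - a k).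
    by rewrite addnS; ring.
  rewrite (le_trans (ler_normD _ _))// (le_trans (lerD (ar _) IHj))//.
  by rewrite addnS exprS le_eqVlt; apply/orP; left; apply/eqP; field.
have cvga : cvgn a.
  have -> : a = (fun n => a 0%N + series (telescope a) n).
    by apply/funext => n; exact: eq_sum_telescope.
  apply: is_cvgD; first exact: is_cvg_cst.
  apply: normed_cvg; apply: (@series_le_cvg _ _ (geometric r 2^-1)).
  - by move=> n; exact: normr_ge0.
  - by move=> n; rewrite /= mulr_ge0// exprn_ge0.
  - by move=> n; exact: ar.
  - by apply: is_cvg_geometric_series; rewrite ger0_norm// invf_lt1// ltr1n.
exists (limn a) => // k; rewrite distrC.
have : (fun n => `|a n - a k|) @ \oo --> `|limn a - a k|.
  by apply: cvg_norm; apply: cvgB => //; exact: cvg_cst.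
move/cvgr_to_le; apply; near=> n.
have kn : (k <= n)%N by near: n; exact: nbhs_infty_ge.
rewrite -(subnKC kn) (le_trans (step _ _))// ler_wpM2l ?mulr_ge0//.
by rewrite gerBl exprn_ge0.
Unshelve. all: by end_near. Qed.

Context d (T : measurableType d).
Variable mu : {measure set T -> \bar R}.

(* The series [S = \sum_k 2^(k p) |u_(k+1) - u_k|^p] has finite integral, and
   where it is finite [|u_k - u|^p <= 2^p 2^(- k p) S]. *)
Lemma Lp_fast_cauchy_cvg (p K : R) (u_ : nat -> T -> R) : 1 < p ->
  (forall k, u_ k \in Lfun mu p%:E) ->
  (forall k, \int[mu]_x (`|u_ k.+1 x - u_ k x| `^ p) <=
             K * ((2^-1 ^+ k) `^ p / (2 ^ k.+1)%:R)) ->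
  exists u, [/\ u \in Lfun mu p%:E,
    {ae mu, forall x, u_ ^~ x @ \oo --> u x},
    forall x, (forall k, u_ k x = 0) -> u x = 0 &
    (fun k => \int[mu]_x (`|u_ k x - u x| `^ p)) @ \oo --> (0 : R)].
Proof.
move=> p1 up dup; have p0 : 0 < p by rewrite (lt_trans ltr01).
have mu_ k : measurable_fun setT (u_ k) := Lfun_measurable p1 (up k).
(* This is 2^(-k p); dividing by it leaves the summable bound K / 2^(k+1) on the integrals. *)
pose h k : R := (2^-1 ^+ k) `^ p.
have h0 k : 0 < h k by rewrite powR_gt0// exprn_gt0// invr_gt0.
pose g k x := (h k)^-1 * `|u_ k.+1 x - u_ k x| `^ p.
have g0 k x : 0 <= g k x by rewrite mulr_ge0 ?powR_ge0// invr_ge0 ltW.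
have ig k : mu.-integrable setT (EFin \o g k).
  by apply: integrableZR; exact/(Lfun_powR_integrable p1)/LfunB.
have mg k := integrable_measurable (ig k).
have Ig k : (\int[mu]_x (g k x)%:E <= (K / (2 ^ k.+1)%:R)%:E)%E.
  have iud := Lfun_powR_integrable p1 (LfunB p1 (up k.+1) (up k)).
  rewrite -[leLHS]fineK; last exact: (integrable_fin_num measurableT (ig k)).
  rewrite lee_fin -/(Rintegral mu setT (g k)) RintegralZl//.
  rewrite ler_pdivrMl// (le_trans (dup k))//.
  by rewrite le_eqVlt; apply/orP; left; apply/eqP; rewrite -/(h k); ring.
have K0 : 0 <= K.
  have Ig0 : (0 <= \int[mu]_x (g 0%N x)%:E)%E.
    by apply: integral_ge0 => x _; rewrite lee_fin.
  by have := le_trans Ig0 (Ig 0%N); rewrite lee_fin pmulr_lge0 ?invr_gt0.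
pose S x := (\sum_(k <oo) (g k x)%:E)%E.
have S0 x : (0 <= S x)%E by apply: nneseries_ge0 => k _ _; rewrite lee_fin.
have mS : measurable_fun setT S.
  apply: (ge0_emeasurable_sum (P := xpredT)) => [k x _ _|k _].
    by rewrite lee_fin.
  exact/measurable_EFinP.
have iS : mu.-integrable setT S.
  apply/integrableP; split => //.
  under eq_integral do rewrite gee0_abs//.
  rewrite integral_nneseries//; last 2 first.
  - by move=> k; exact/measurable_EFinP.
  - by move=> k x _; rewrite lee_fin.
  (* The weights 2^(-(k+1)) sum to 1, so [S] has integral at most [K]. *)
  apply: (@le_lt_trans _ _ K%:E); last exact: ltry.
  apply: le_trans (epsilon_trick0 xpredT K0).
  apply: lee_nneseries => [k _ _|k _]; last exact: Ig.
  by apply: integral_ge0 => x _; rewrite lee_fin.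
pose s x := fine (S x).
have ms : measurable_fun setT s by exact: measurableT_comp.
have is_ : mu.-integrable setT (EFin \o s).
  apply: le_integrable iS => //; first exact/measurable_EFinP.
  by move=> x _; rewrite /= /s; case: (S x) => //=; rewrite ?normr0 ?leey.
have s0 x : 0 <= s x by exact: fine_ge0.
pose E := [set x | S x \is a fin_num].
have mE : measurable E.
  by rewrite -[E]setTI; exact: emeasurable_fin_num.
have aeE : {ae mu, forall x, E x}.
  by have := integrable_ae measurableT iS; apply: filterS => x /(_ I).
pose r x := s x `^ p^-1.
have rp x : r x `^ p = s x by rewrite -powRrM mulVf ?gt_eqF// powRr1.
have step x : E x -> forall k, `|u_ k.+1 x - u_ k x| <= r x * 2^-1 ^+ k.
  move=> Ex k; have gS : g k x <= s x.
    rewrite -lee_fin fineK//.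
    have gk0 i : (0 <= i)%N -> xpredT i -> (0 <= (g i x)%:E)%E.
      by rewrite lee_fin.
    apply: le_trans (nneseries_lim_ge k.+1 gk0).
    by rewrite big_nat_recr//= leeDr// sume_ge0// => i _; rewrite lee_fin.
  have hr : 0 <= r x * 2^-1 ^+ k by rewrite mulr_ge0 ?exprn_ge0 ?powR_ge0.
  have dr : `|u_ k.+1 x - u_ k x| `^ p <= (r x * 2^-1 ^+ k) `^ p.
    by rewrite powRM ?powR_ge0 ?exprn_ge0// rp mulrC -ler_pdivrMl.
  rewrite leNgt; apply/negP => /(gt0_ltr_powR p0 hr (normr_ge0 _)).
  by rewrite ltNge dr.
(* The value 0 off [E] makes the clause about zeros hold at every point, and makes [u] the
   everywhere limit of [u_ k * \1_E], hence measurable. *)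
pose u x := if x \in E then limn (u_ ^~ x) else 0.
have cvgu x : E x -> u_ ^~ x @ \oo --> u x.
  move=> Ex; rewrite /u mem_set//.
  by have [l ul _] := cvg_geometric_steps (step x Ex); apply/cvg_ex; exists l.
have distu x : E x -> forall k, `|u_ k x - u x| <= 2 * r x * 2^-1 ^+ k.
  move=> Ex k; have [l ul] := cvg_geometric_steps (step x Ex).
  by have <- := cvg_unique _ ul (cvgu x Ex).
have mu0 : measurable_fun setT u.
  apply: (@measurable_fun_cvg _ _ _ _ (fun k x => u_ k x * \1_E x)).
    by move=> k; apply: measurable_funM.
  move=> x _; rewrite indicE; have [xE|xE] := boolP (x \in E).
    under eq_fun do rewrite mulr1; exact/cvgu/set_mem.
  by under eq_fun do rewrite mulr0; rewrite /u (negbTE xE); exact: cvg_cst.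
have dist_ae k : {ae mu, forall x, `|u_ k x - u x| `^ p <= (2 `^ p * h k) * s x}.
  apply: filterS aeE => x /distu /(_ k) du.
  have rhs0 : 0 <= 2 * r x * 2^-1 ^+ k.
    by rewrite !mulr_ge0 ?powR_ge0// exprn_ge0.
  have := ge0_ler_powR (ltW p0) _ rhs0 du.
  rewrite nnegrE => /(_ (normr_ge0 _)) /le_trans; apply.
  rewrite !powRM ?mulr_ge0 ?powR_ge0 ?exprn_ge0// rp.
  by rewrite mulrAC.
have idist k : mu.-integrable setT (EFin \o (fun x => `|u_ k x - u x| `^ p)).
  apply: (@integrable_ae_le _ _ _ _ _ (fun x => (2 `^ p * h k) * s x)).
  - by apply: measurable_norm_powR; exact: measurable_funB.
  - have := dist_ae k; apply: filterS => x.
    by rewrite [`|_ `^ _|]ger0_norm ?powR_ge0.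
  - exact: integrableZR.
exists u; split.
- have uud : (fun x => u_ 0%N x - u x) \in Lfun mu p%:E.
    by apply/Lfun_powRP => //; split => //; exact: measurable_funB.
  have := LfunB p1 (up 0%N) uud.
  by under eq_fun do rewrite opprB addrC subrK.
- by apply: filterS aeE => x; exact: cvgu.
- move=> x ux; rewrite /u; case: ifPn => // _.
  by under eq_fun do rewrite ux; exact: lim_cst.
- apply: (@squeeze_cvgr _ _ _ _ (fun=> 0)
      (fun k => 2 `^ p * \int[mu]_x s x * 2^-1 ^+ k)).
  + near=> k; apply/andP; split.
      by apply: Rintegral_ge0 => x _; exact: powR_ge0.
    apply: (@le_trans _ _ (\int[mu]_x ((2 `^ p * h k) * s x))).
      by apply: ae_le_Rintegral => //; exact: integrableZR.
    rewrite RintegralZl// mulrAC ler_wpM2l//.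
      by rewrite mulr_ge0 ?powR_ge0// Rintegral_ge0.
    (* (2^(-k))^p <= 2^(-k), because p >= 1 and the base is at most 1. *)
    rewrite /h; apply: ge1r_powR; last exact: ltW.
    by rewrite exprn_gt0 ?invr_gt0//= exprn_ile1 ?invr_ge0// invf_le1 ?ler1n.
  + exact: cvg_cst.
  + by apply: (@cvg_geometric R); rewrite ger0_norm// invf_lt1// ltr1n.
Unshelve. all: by end_near. Qed.

End Lp_completeness.

(** * Bounded weights and passage to the limit under the integral *)

Section weighted_integrals.
Context d (T : measurableType d) (R : realType).
Variable mu : {measure set T -> \bar R}.

Lemma integrable_bounded_mul (M : R) (k f : T -> R) : measurable_fun setT k ->
  (forall x, `|k x| <= M) -> mu.-integrable setT (EFin \o f) ->
  mu.-integrable setT (EFin \o (fun x => k x * f x)).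
Proof.
move=> mk kM fi.
apply: integrable_le (integrableZR M (integrable_norm fi)).
  by apply: measurable_funM => //; exact: integrable_measurable fi.
by move=> x; rewrite /= normrM ler_wpM2r.
Qed.

Lemma Rintegral_dominated_cvg (F : nat -> T -> R) (f g : T -> R) :
  (forall n, measurable_fun setT (F n)) -> measurable_fun setT f ->
  (forall x, F ^~ x @ \oo --> f x) -> mu.-integrable setT (EFin \o g) ->
  (forall n x, `|F n x| <= g x) ->
  (fun n => \int[mu]_x F n x) @ \oo --> \int[mu]_x f x.
Proof.
move=> mF mf Ff ig Fg.
have [||||//|if_ _ cvgI] := @dominated_convergence _ _ _ mu _ measurableT
  (fun n => EFin \o F n) (EFin \o f) (EFin \o g).
- by move=> n; exact/measurable_EFinP.
- exact/measurable_EFinP.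
- by apply: aeW => x _; apply: cvg_EFin; [exact: nearW|exact: Ff].
- exact: ig.
- by apply: aeW => x n _; rewrite lee_fin.
by apply: fine_cvg; rewrite fineK//; exact: (integrable_fin_num measurableT if_).
Qed.

Lemma Lfun_bounded_mul (p M : R) (k u : T -> R) : 1 < p ->
  measurable_fun setT k -> (forall x, `|k x| <= M) -> u \in Lfun mu p%:E ->
  (fun x => k x * u x) \in Lfun mu p%:E.
Proof.
move=> p1 mk kM up.
have zero_p : (fun=> 0) \in Lfun mu p%:E.
  apply: (Lfun_le p1 _ up) => // x.
  by rewrite normr0.
apply: (Lfun_le p1 _ (LfunDZ M p1 zero_p up)).
  by apply: measurable_funM => //; exact: Lfun_measurable p1 up.
move=> x; rewrite add0r !normrM ler_wpM2r//.
by rewrite (le_trans (kM x))// ler_norm.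
Qed.

(** Young's inequality splits |v (w_k - w)| into a small multiple of |v|^q and a large multiple of
    |w_k - w|^p, whose integral tends to 0. *)
Lemma Lfun_weak_cvg (p q : R) (v w : T -> R) (w_ : nat -> T -> R) :
  1 < p -> p^-1 + q^-1 = 1 -> v \in Lfun mu q%:E ->
  w \in Lfun mu p%:E -> (forall k, w_ k \in Lfun mu p%:E) ->
  (fun k => \int[mu]_x (`|w_ k x - w x| `^ p)) @ \oo --> (0 : R) ->
  (fun k => \int[mu]_x (v x * (w_ k x - w x))) @ \oo --> (0 : R).
Proof.
move=> p1 pq vq wp w_p ww; have [q1 _] := conjugate_exponent p1 pq.
have qp : q^-1 + p^-1 = 1 by rewrite addrC.
have iv := Lfun_powR_integrable q1 vq.
set F := \int[mu]_x (`|v x| `^ q).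
have F0 : 0 <= F by apply: Rintegral_ge0 => x _; exact: powR_ge0.
apply/cvgr0Pnorm_lt => e e0.
(* This factor makes the |v|^q part at most e / 2; the + 1 covers a vanishing [F]. *)
have eta0 : 0 < e / (2 * (F + 1)) by rewrite divr_gt0// mulr_gt0// ltr_wpDl.
have [K K0 KP] := young_eps q1 qp eta0.
have etaF : e / (2 * (F + 1)) * F <= e / 2.
  rewrite invfM mulrA -mulrA ler_piMr ?divr_ge0 ?(ltW e0)//.
  by rewrite ler_pdivrMl ?mulr1 ?lerDl// ltr_wpDl.
near=> n.
have dn := LfunB p1 (w_p n) wp.
have ivd := integrable_LfunM q1 qp vq dn.
have idn := Lfun_powR_integrable p1 dn.
apply: (le_lt_trans (le_normr_Rintegral measurableT ivd)).
apply: (@le_lt_trans _ _ (e / 2 + K * \int[mu]_x (`|w_ n x - w x| `^ p))).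
  apply: le_trans (lerD etaF (lexx _)).
  rewrite -!RintegralZl// -RintegralD//; [|exact: integrableZR..].
  apply: le_RintegralT; [exact: integrable_norm ivd| |by move=> x; exact: KP].
  by apply: integrableDR; exact: integrableZR.
rewrite [ltRHS]splitr ltrD2l -ltr_pdivlMl// mulrC.
apply: le_lt_trans (ler_norm _) _; near: n.
by apply: cvgr0_norm_lt => //; rewrite divr_gt0// divr_gt0.
Unshelve. all: by end_near. Qed.

End weighted_integrals.

(** * Existence for the primal problem and its Euler-Lagrange equation *)

(* A closed linear operator [G : V -> L^p(nu)], [V] a subspace of [L^p(mu)], for
   which a Poincare inequality holds; [kappa] is a weight bounded above and below. *)
Section weak_solution.
Context d1 d2 (T1 : measurableType d1) (T2 : measurableType d2) (R : realType).
Variables (mu : {measure set T1 -> \bar R}) (nu : {measure set T2 -> \bar R}).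
Variables (p q : R) (p1 : 1 < p) (pq : p^-1 + q^-1 = 1).
Variables (V : set (T1 -> R)) (G : (T1 -> R) -> T2 -> R).
Hypothesis V_Lp : forall u, V u -> u \in Lfun mu p%:E.
Hypothesis G_Lp : forall u, V u -> G u \in Lfun nu p%:E.
Hypothesis V0 : V (fun=> 0).
Hypothesis V_lin : forall u v c, V u -> V v -> V (fun x => u x + c * v x).
Hypothesis G_lin : forall u v c z,
  G (fun x => u x + c * v x) z = G u z + c * G v z.
(** Closedness is phrased with a.e. limits because fast Cauchy sequences supply them. The clause on
    common zeros carries the support condition over to the limit at every point. *)
Hypothesis G_closed : forall (u_ : nat -> T1 -> R) u h, (forall k, V (u_ k)) ->
  u \in Lfun mu p%:E -> {ae mu, forall x, u_ ^~ x @ \oo --> u x} ->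
  (forall x, (forall k, u_ k x = 0) -> u x = 0) ->
  h \in Lfun nu p%:E -> {ae nu, forall z, (fun k => G (u_ k) z) @ \oo --> h z} ->
  V u /\ {ae nu, forall z, G u z = h z}.
Variable K : R.
Hypothesis K_gt0 : 0 < K.
Hypothesis poincare : forall u, V u ->
  \int[mu]_x (`|u x| `^ p) <= K * \int[nu]_z (`|G u z| `^ p).
Variables (kappa : T2 -> R) (kmin kmax : R).
Hypothesis mk : measurable_fun setT kappa.
Hypothesis kmin_gt0 : 0 < kmin.
Hypothesis k_bounds : forall z, kmin <= kappa z <= kmax.
Variable f : T1 -> R.
Hypothesis f_Lq : f \in Lfun mu q%:E.

Let p0 : 0 < p. Proof. exact: lt_trans p1. Qed.
Let q1 : 1 < q. Proof. by have [] := conjugate_exponent p1 pq. Qed.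
Let qp : q^-1 + p^-1 = 1. Proof. by rewrite addrC. Qed.
Let k0 z : 0 < kappa z.
Proof. by have /andP[+ _] := k_bounds z; exact: lt_le_trans. Qed.
Let knorm z : `|kappa z| <= kmax.
Proof. by have /andP[_] := k_bounds z; rewrite gtr0_norm. Qed.

Let G_sub u v z : G (fun x => u x - v x) z = G u z - G v z.
Proof.
rewrite -[in RHS]mulN1r -G_lin; congr (G _ z); apply/funext => x.
by rewrite mulN1r.
Qed.

Let G_const0 z : G (fun=> 0) z = 0.
Proof. by have := G_sub (fun=> 0) (fun=> 0) z; rewrite !subrr. Qed.

Let iG u : V u -> nu.-integrable setT (EFin \o (fun z => `|G u z| `^ p)).
Proof. by move=> /G_Lp; exact: Lfun_powR_integrable. Qed.

Let ikG u : V u ->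
  nu.-integrable setT (EFin \o (fun z => kappa z * `|G u z| `^ p)).
Proof. by move=> /iG; exact: integrable_bounded_mul. Qed.

Let ifu u : V u -> mu.-integrable setT (EFin \o (fun x => f x * u x)).
Proof. by move=> /V_Lp; exact: integrable_LfunM q1 qp f_Lq. Qed.

Definition dirichlet u : R :=
  p^-1 * \int[nu]_z (kappa z * `|G u z| `^ p) - \int[mu]_x (f x * u x).

Let I u := \int[nu]_z (`|G u z| `^ p).

Let I_ge0 u : 0 <= I u.
Proof. by apply: Rintegral_ge0 => z _; exact: powR_ge0. Qed.

Let kI u : V u -> kmin * I u <= \int[nu]_z (kappa z * `|G u z| `^ p).
Proof.
move=> Vu; rewrite -RintegralZl//; last exact: iG.
apply: le_RintegralT; [exact/integrableZR/iG|exact: ikG|move=> z].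
by rewrite ler_wpM2r ?powR_ge0//; have /andP[] := k_bounds z.
Qed.

Let dirichlet_coercive : exists2 M, 0 <= M & forall u, V u ->
  kmin / (2 * p) * I u <= dirichlet u + M.
Proof.
(* After Poincare, eta times the integral of |u|^p is at most kmin / (2 p) * [I u], which is half of
   the available kmin / p * [I u]. *)
have eta0 : 0 < kmin / (2 * p * K) by rewrite divr_gt0// !mulr_gt0.
have [C C0 CP] := young_eps p1 pq eta0.
have iF := Lfun_powR_integrable q1 f_Lq.
exists (C * \int[mu]_x (`|f x| `^ q)).
  by rewrite mulr_ge0 ?(ltW C0)// Rintegral_ge0// => x _; exact: powR_ge0.
move=> u Vu; have iu := Lfun_powR_integrable p1 (V_Lp Vu).
have fu : \int[mu]_x (f x * u x) <=
    kmin / (2 * p * K) * \int[mu]_x (`|u x| `^ p) +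
    C * \int[mu]_x (`|f x| `^ q).
  rewrite -!RintegralZl// -RintegralD//; [|exact: integrableZR..].
  apply: le_RintegralT; first exact: ifu.
    by apply: integrableDR; exact: integrableZR.
  by move=> x; rewrite (le_trans (ler_norm _))// mulrC; exact: CP.
have Ku : kmin / (2 * p * K) * \int[mu]_x (`|u x| `^ p) <= kmin / (2 * p) * I u.
  apply: le_trans (ler_wpM2l (ltW eta0) (poincare Vu)) _.
  rewrite le_eqVlt; apply/orP; left; apply/eqP; rewrite -/(I u).
  by field; rewrite !gt_eqF.
have half : p^-1 * (kmin * I u) = kmin / (2 * p) * I u + kmin / (2 * p) * I u.
  by field; rewrite gt_eqF.
have arith (c x a b F i n : R) : 0 <= c -> x <= a -> b <= n + F -> n <= i ->
    c * x = i + i -> i <= c * a - b + F.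
  move=> c0 xa bF ni xi; rewrite -subr_ge0.
  have -> : c * a - b + F - i =
      (c * a - c * x) + (i - n) + (n + F - b) + (c * x - (i + i)) by ring.
  rewrite [X in X - (i + i)]xi subrr addr0.
  apply: addr_ge0; last by rewrite subr_ge0.
  by apply: addr_ge0; rewrite subr_ge0// ler_wpM2l.
have pV : 0 <= p^-1 by rewrite invr_ge0 ltW.
exact: arith pV (kI Vu) fu Ku half.
Qed.

(** The midpoint of u and v, in the shape that two uses of [V_lin] produce and [G_lin] unfolds. *)
Let V_half u v : V u -> V v -> V (fun x => 0 + 2^-1 * (u x + 1 * v x)).
Proof. by move=> Vu Vv; exact/V_lin/V_lin. Qed.

Let integrable_midgap u v : V u -> V v ->
  nu.-integrable setT (EFin \o (fun z => midgap p (G u z) (G v z))).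
Proof.
move=> Vu Vv.
rewrite (_ : (fun z => _) = (fun z => `|G u z| `^ p + `|G v z| `^ p -
    2 * `|G (fun x => 0 + 2^-1 * (u x + 1 * v x)) z| `^ p)); last first.
  apply/funext => z; rewrite /midgap 2!G_lin G_const0 add0r mul1r.
  by rewrite [2^-1 * _]mulrC.
apply: integrableBR; first by apply: integrableDR; exact: iG.
exact/integrableZR/iG/V_half.
Qed.

(** In dirichlet u + dirichlet v - 2 dirichlet w, with w the midpoint, the linear terms cancel and
    the weighted midpoint gap is left; then dirichlet w >= m is used. *)
Let dirichlet_midgap m u v : (forall w, V w -> m <= dirichlet w) ->
  V u -> V v -> kmin / p * \int[nu]_z midgap p (G u z) (G v z) <=
                dirichlet u + dirichlet v - 2 * m.
Proof.
move=> mJ Vu Vv; have Vw := V_half Vu Vv.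
set w := (fun x => 0 + 2^-1 * (u x + 1 * v x)) in Vw.
have Gw z : G w z = (G u z + G v z) / 2.
  by rewrite 2!G_lin G_const0 add0r mul1r mulrC.
have img := integrable_midgap Vu Vv.
have fw : \int[mu]_x (f x * u x) + \int[mu]_x (f x * v x) =
    2 * \int[mu]_x (f x * w x).
  rewrite -RintegralZl//; last exact: ifu.
  rewrite -RintegralD//; [|exact: ifu..].
  by apply: eq_Rintegral => x _; rewrite /w; field.
have kw : \int[nu]_z (kappa z * midgap p (G u z) (G v z)) =
    \int[nu]_z (kappa z * `|G u z| `^ p) + \int[nu]_z (kappa z * `|G v z| `^ p) -
    2 * \int[nu]_z (kappa z * `|G w z| `^ p).
  rewrite -RintegralZl//; last exact: ikG.
  rewrite -RintegralD//; [|exact: ikG..].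
  rewrite -RintegralB//; last 2 first.
    by apply: integrableDR; exact: ikG.
    exact/integrableZR/ikG.
  by apply: eq_Rintegral => z _; rewrite /midgap Gw; ring.
have kmg : kmin * \int[nu]_z midgap p (G u z) (G v z) <=
    \int[nu]_z (kappa z * midgap p (G u z) (G v z)).
  rewrite -RintegralZl//; apply: le_RintegralT.
  - exact: integrableZR.
  - exact: integrable_bounded_mul.
  - by move=> z; rewrite ler_wpM2r ?midgap_ge0//; have /andP[] := k_bounds z.
have arith (c y x a1 a2 a3 b1 b2 b3 : R) : kmin * y <= x ->
    x = a1 + a2 - 2 * a3 -> b1 + b2 = 2 * b3 -> 0 <= c -> m <= c * a3 - b3 ->
    kmin * c * y <= c * a1 - b1 + (c * a2 - b2) - 2 * m.
  move=> yx xE bE c0 ma.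
  have -> : c * a1 - b1 + (c * a2 - b2) - 2 * m = c * (a1 + a2 - 2 * a3) +
      2 * (c * a3 - b3 - m) + (2 * b3 - (b1 + b2)) by ring.
  rewrite bE subrr addr0 -xE [kmin * c]mulrC -mulrA.
  by apply: le_trans (ler_wpM2l c0 yx) _; rewrite lerDl mulr_ge0// subr_ge0.
have pV : 0 <= p^-1 by rewrite invr_ge0 ltW.
exact: arith kmg kw fw pV (mJ _ Vw).
Qed.

Let dirichlet_cauchy m : (forall w, V w -> m <= dirichlet w) ->
  forall e, 0 < e -> exists2 dl, 0 < dl & forall u v, V u -> V v ->
    dirichlet u < m + dl -> dirichlet v < m + dl ->
    \int[nu]_z (`|G u z - G v z| `^ p) <= e.
Proof.
move=> mJ e e0; have [M M0 MP] := dirichlet_coercive.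
pose c := kmin / (2 * p); have c0 : 0 < c by rewrite divr_gt0// mulr_gt0.
(* By coercivity, [B] bounds [I] on all functions whose value is within 1 of [m]. *)
pose B := Num.max 0 ((m + 1 + M) / c).
have B0 : 0 <= B by rewrite le_max lexx.
have IB u : V u -> dirichlet u < m + 1 -> I u <= B.
  move=> Vu Ju; rewrite le_max; apply/orP; right.
  by rewrite ler_pdivlMr// mulrC (le_trans (MP _ Vu))// lerD2r ltW.
have eps0 : 0 < e / (4 * (B + 1)) by rewrite divr_gt0// mulr_gt0// ltr_wpDl.
have [C C0 CP] := uniformly_convex_powR p1 eps0.
(* The entry 1 brings [I u] and [I v] under [B]; the other makes C p / kmin * (2 dl) at most e / 2.
   The eps term takes the remaining e / 2. *)
pose dl := Num.min 1 (e * kmin / (4 * C * p)).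
have dl0 : 0 < dl by rewrite lt_min ltr01 divr_gt0 ?mulr_gt0.
exists dl => // u v Vu Vv Ju Jv.
have dl1 : dl <= 1 by rewrite ge_min lexx.
have dlC : dl <= e * kmin / (4 * C * p) by rewrite ge_min lexx orbT.
have Iu : I u <= B by apply: IB => //; rewrite (lt_le_trans Ju)// lerD2l.
have Iv : I v <= B by apply: IB => //; rewrite (lt_le_trans Jv)// lerD2l.
have img := integrable_midgap Vu Vv.
have iGu := iG Vu; have iGv := iG Vv.
apply: (@le_trans _ _ (e / (4 * (B + 1)) * (I u + I v) +
    C * \int[nu]_z midgap p (G u z) (G v z))).
  rewrite /I -RintegralD// -!RintegralZl//; last exact: integrableDR.
  rewrite -RintegralD//; last 2 first.
    exact/integrableZR/integrableDR.
    exact: integrableZR.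
  apply: le_RintegralT; [| |by move=> z; exact: CP].
  - exact: Lfun_powR_integrable p1 (LfunB p1 (G_Lp Vu) (G_Lp Vv)).
  - apply: integrableDR; last exact: integrableZR.
    exact/integrableZR/integrableDR.
have le1 : e / (4 * (B + 1)) * (I u + I v) <= e / 2.
  have -> : e / 2 = e / (4 * (B + 1)) * (2 * (B + 1)).
    by field; rewrite gt_eqF// ltr_wpDl.
  rewrite ler_wpM2l ?(ltW eps0)// (le_trans (lerD Iu Iv))//.
  by rewrite mulrDr [2 * B]mulr_natl mulr2n lerDl mulr1.
have le2 : C * \int[nu]_z midgap p (G u z) (G v z) <= e / 2.
  have -> : e / 2 = (C * p / kmin) * (2 * (e * kmin / (4 * C * p))).
    by field; rewrite !gt_eqF.
  have -> : C * \int[nu]_z midgap p (G u z) (G v z) =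
      (C * p / kmin) * (kmin / p * \int[nu]_z midgap p (G u z) (G v z)).
    by field; rewrite !gt_eqF.
  have Cpk : 0 <= C * p / kmin by rewrite ltW// divr_gt0// mulr_gt0.
  rewrite ler_wpM2l// (le_trans (dirichlet_midgap mJ Vu Vv))//.
  rewrite lerBlDr (le_trans (lerD (ltW Ju) (ltW Jv)))//.
  rewrite (_ : m + dl + (m + dl) = 2 * dl + 2 * m); last by ring.
  by rewrite lerD2r ler_wpM2l.
by rewrite [leRHS]splitr lerD.
Qed.

Lemma dirichlet_minimizer : exists2 u, V u &
  forall v, V v -> dirichlet u <= dirichlet v.
Proof.
pose JV := [set dirichlet u | u in V].
have [M M0 MP] := dirichlet_coercive.
have JV_inf : has_inf JV.
  split; first by exists (dirichlet (fun=> 0)), (fun=> 0).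
  exists (- M) => _ [u Vu <-]; rewrite -subr_ge0 opprK.
  apply: le_trans (MP _ Vu); rewrite mulr_ge0 ?I_ge0// ltW// divr_gt0//.
  by rewrite mulr_gt0.
pose m := inf JV.
have mJ w : V w -> m <= dirichlet w.
  by move=> Vw; apply: ge_inf => //; [exact: JV_inf.2|exists w].
(* The rate that [Lp_fast_cauchy_cvg] asks for. *)
pose e_ k : R := (2^-1 ^+ k) `^ p / (2 ^ k.+1)%:R.
have e0 k : 0 < e_ k.
  by rewrite divr_gt0 ?powR_gt0 ?exprn_gt0 ?invr_gt0// ltr0n expn_gt0.
have /choice[dl dlP] : forall k, exists dl, 0 < dl /\
    forall u v, V u -> V v -> dirichlet u < m + dl ->
      dirichlet v < m + dl -> \int[nu]_z (`|G u z - G v z| `^ p) <= e_ k.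
  by move=> k; have [dl ? ?] := dirichlet_cauchy mJ (e0 k); exists dl.
(* [u_ k] occurs in the differences with both [u_ k.+1] and [u_ k.-1], hence the tolerances [dl k]
   and [dl k.-1]; the entry 1 / (k + 1) forces the values to tend to [m]. *)
pose a k := Num.min (dl k) (Num.min (dl k.-1) k.+1%:R^-1).
have a0 k : 0 < a k by rewrite !lt_min !(dlP _).1/= invr_gt0.
have /choice[u_ u_P] : forall k, exists u, V u /\ dirichlet u < m + a k.
  by move=> k; have [_ [u Vu <-] Ju] := inf_adherent (a0 k) JV_inf; exists u.
have Vu k : V (u_ k) := (u_P k).1.
have Ju1 k : dirichlet (u_ k) < m + dl k.
  by rewrite (lt_le_trans (u_P k).2)// lerD2l ge_min lexx.
have Ju2 k : dirichlet (u_ k.+1) < m + dl k.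
  by rewrite (lt_le_trans (u_P k.+1).2)// lerD2l !ge_min lexx orbT.
have Ju : (fun k => dirichlet (u_ k)) @ \oo --> m.
  apply/cvgrPdist_lt => e e_gt0; near=> k.
  rewrite distrC ger0_norm ?subr_ge0 ?mJ// ltrBlDl.
  rewrite (lt_trans (u_P k).2)// ltrD2l !gt_min; apply/orP; right; apply/orP; right.
  by near: k; exact: (near_infty_natSinv_lt (PosNum e_gt0)).
have dG k : \int[nu]_z (`|G (u_ k.+1) z - G (u_ k) z| `^ p) <= e_ k.
  by apply: (dlP k).2.
have [h [h_Lp Gh _ Gh_int]] : exists h, [/\ h \in Lfun nu p%:E,
    {ae nu, forall z, (fun k => G (u_ k) z) @ \oo --> h z},
    forall z, (forall k, G (u_ k) z = 0) -> h z = 0 &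
    (fun k => \int[nu]_z (`|G (u_ k) z - h z| `^ p)) @ \oo --> (0 : R)].
  apply: (Lp_fast_cauchy_cvg (K := 1) (u_ := fun k => G (u_ k)) p1).
    by move=> n; exact/G_Lp.
  by move=> n; rewrite mul1r; exact: dG.
have [u [u_Lp uu u0 uu_int]] : exists u, [/\ u \in Lfun mu p%:E,
    {ae mu, forall x, u_ ^~ x @ \oo --> u x},
    forall x, (forall k, u_ k x = 0) -> u x = 0 &
    (fun k => \int[mu]_x (`|u_ k x - u x| `^ p)) @ \oo --> (0 : R)].
  (* Poincare transfers the rate from the gradients to the functions, at the price of the factor
     [K]. *)
  apply: (Lp_fast_cauchy_cvg (K := K) p1) => n; first exact: V_Lp.
  have Vd : V (fun x => u_ n.+1 x - u_ n x).
    have := V_lin (-1) (Vu n.+1) (Vu n).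
    by under eq_fun do rewrite mulN1r.
  apply: le_trans (poincare Vd) _; rewrite ler_wpM2l ?(ltW K_gt0)//.
  by under eq_Rintegral do rewrite G_sub; exact: dG.
have [Vulim Guh] := G_closed Vu u_Lp uu u0 h_Lp Gh.
exists u => // v Vv; apply: le_trans (mJ _ Vv).
have kdh : (fun z => kappa z * dpow p (h z)) \in Lfun nu q%:E.
  exact: Lfun_bounded_mul q1 mk knorm (Lfun_dpow p1 pq h_Lp).
have cvg1 := Lfun_weak_cvg p1 pq kdh h_Lp (fun k => G_Lp (Vu k)) Gh_int.
have cvg2 := Lfun_weak_cvg p1 pq f_Lq u_Lp (fun k => V_Lp (Vu k)) uu_int.
(* By the tangent inequality at [h], each term of this sequence is at least [dirichlet u]; both
   corrections tend to 0, so [dirichlet u] is at most the limit [m]. *)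
have Jlim : (fun k => dirichlet (u_ k) -
    \int[nu]_z (kappa z * dpow p (h z) * (G (u_ k) z - h z)) +
    \int[mu]_x (f x * (u_ k x - u x))) @ \oo --> m - 0 + 0.
  exact: (cvgD (cvgB Ju cvg1) cvg2).
rewrite subr0 addr0 in Jlim; apply: (cvgr_to_ge Jlim); near=> n.
have ih := Lfun_powR_integrable p1 h_Lp.
have ikh := integrable_bounded_mul mk knorm ih.
have IGh : \int[nu]_z (kappa z * `|G u z| `^ p) =
    \int[nu]_z (kappa z * `|h z| `^ p).
  apply: ae_eq_Rintegral.
  - exact: integrable_measurable (ikG Vulim).
  - exact: integrable_measurable ikh.
  - by apply: filterS Guh => z ->.
have fun_ : \int[mu]_x (f x * (u_ n x - u x)) =
    \int[mu]_x (f x * u_ n x) - \int[mu]_x (f x * u x).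
  rewrite -(RintegralB measurableT (ifu (Vu n)) (ifu Vulim)).
  by apply: eq_Rintegral => x _; rewrite mulrBr.
have igd := integrable_LfunM q1 qp kdh (LfunB p1 (G_Lp (Vu n)) h_Lp).
have arith (c x x' b bn t y J' : R) : x = x' -> y = bn - b ->
    c * x' + t <= J' -> c * x - b <= J' - bn - t + y.
  move=> -> -> xtJ; have -> : J' - bn - t + (bn - b) = J' - t - b by ring.
  by rewrite lerD2r lerBrDr.
apply: (arith _ _ _ _ _ _ _ _ IGh fun_).
have ipkh := integrableZR p^-1 ikh.
have sum_le (c x y t x' y' xt : R) : x' = c * x -> y' = c * y ->
    xt = x' + t -> xt <= y' -> c * x + t <= c * y by move=> <- <- <-.
apply: (sum_le _ _ _ _ _ _ _ (RintegralZl _ measurableT ikh)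
  (RintegralZl _ measurableT (ikG (Vu n))) (RintegralD measurableT ipkh igd)).
apply: le_RintegralT.
- exact: integrableDR ipkh igd.
- exact: integrableZR (ikG (Vu n)).
move=> z; have := dpow_tangent_le (h z) (G (u_ n) z) p1.
move/(ler_wpM2l (ltW (k0 z))); rewrite -subr_ge0 => tan.
rewrite -subr_ge0; apply: le_trans tan _.
by rewrite le_eqVlt; apply/orP; left; apply/eqP; ring.
Unshelve. all: by end_near. Qed.

(** No differentiation under the integral: the tangent at w = u + t v, evaluated at u, gives t J'(w)
    v >= J(w) - J(u) >= 0 for J = [dirichlet]. Then t = 1 / (n + 1) tends to 0 by dominated
    convergence. *)
Let euler_lagrange_ge u : V u -> (forall v, V v -> dirichlet u <= dirichlet v) ->
  forall v, V v ->
  \int[mu]_x (f x * v x) <= \int[nu]_z (kappa z * dpow p (G u z) * G v z).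
Proof.
move=> Vu umin v Vv.
pose F n z := kappa z * dpow p (G u z + n.+1%:R^-1 * G v z) * G v z.
(* A bound for every [F n]: both |G u + t G v| and |G v| are at most |G u| + |G v| when 0 < t <= 1.
   The factor 1 matches [LfunDZ]. *)
pose g z := kmax * `| `|G u z| + 1 * `|G v z| | `^ p.
have mGu := Lfun_measurable p1 (G_Lp Vu).
have mGv := Lfun_measurable p1 (G_Lp Vv).
have mF n : measurable_fun setT (F n).
  apply: measurable_funM => //; apply: measurable_funM => //.
  by apply: measurable_dpow; apply: measurable_funD => //; exact: measurable_funM.
have norm_Lp w : w \in Lfun nu p%:E -> (fun z => `|w z|) \in Lfun nu p%:E.
  move=> wp; apply: (Lfun_le p1 _ wp) => [|z]; last by rewrite normr_id.
  by apply: measurableT_comp => //; exact: Lfun_measurable p1 wp.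
have ig : nu.-integrable setT (EFin \o g).
  apply: integrableZR; apply: Lfun_powR_integrable p1 _.
  by apply: LfunDZ => //; apply: norm_Lp; exact: G_Lp.
have Fg n z : `|F n z| <= g z.
  rewrite /F /g mul1r normrM (normrM (kappa z)) -mulrA ler_pM//.
  set s := `|G u z| + `|G v z|.
  have s0 : 0 <= s by rewrite addr_ge0.
  have us : `|G u z + n.+1%:R^-1 * G v z| <= s.
    rewrite (le_trans (ler_normD _ _))// lerD2l normrM ger0_norm ?invr_ge0//.
    by rewrite ler_piMl// invf_le1// ler1n.
  rewrite (ger0_norm s0) -(mulr_powRB1 s0 p0) mulrC norm_dpow// ler_pM ?powR_ge0//.
    by rewrite /s lerDr.
  by apply: (ge0_ler_powR _ _ _ us); rewrite ?nnegrE// subr_ge0 ltW.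
have iF n : nu.-integrable setT (EFin \o F n).
  exact: integrable_le (mF n) (Fg n) ig.
have cvgF z : (fun n => F n z) @ \oo --> kappa z * dpow p (G u z) * G v z.
  apply: cvgMl; apply: cvgMr.
  apply: (@continuous_cvg _ _ _ _ _ _ (dpow p)); first exact: continuous_dpow.
  rewrite -[X in _ --> X]addr0 -[X in _ + X](mul0r (G v z)).
  apply: cvgD; first exact: cvg_cst.
  by apply: cvgMl; exact: cvg_harmonic.
have step n : \int[mu]_x (f x * v x) <= \int[nu]_z F n z.
  pose t : R := n.+1%:R^-1; have t0 : 0 < t by rewrite invr_gt0.
  have Vw := V_lin t Vu Vv; have := umin _ Vw.
  set w := (fun x => u x + t * v x) in Vw *.
  have Gw z : G w z = G u z + t * G v z by exact: G_lin.
  have fw : \int[mu]_x (f x * w x) =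
      \int[mu]_x (f x * u x) + t * \int[mu]_x (f x * v x).
    rewrite -(RintegralZl _ measurableT (ifu Vv)).
    rewrite -(RintegralD measurableT (ifu Vu) (integrableZR t (ifu Vv))).
    by apply: eq_Rintegral => x _; rewrite /w; ring.
  have kw : p^-1 * \int[nu]_z (kappa z * `|G w z| `^ p) <=
      p^-1 * \int[nu]_z (kappa z * `|G u z| `^ p) + t * \int[nu]_z F n z.
    have i1 := integrableZR p^-1 (ikG Vu); have i2 := integrableZR t (iF n).
    have sum_ge (c x y z x' y' z' yz : R) : x' = c * x -> y' = c * y ->
      z' = t * z -> yz = y' + z' -> x' <= yz -> c * x <= c * y + t * z.
      by move=> <- <- <- <-.
    apply: (sum_ge _ _ _ _ _ _ _ _ (RintegralZl _ measurableT (ikG Vw))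
      (RintegralZl _ measurableT (ikG Vu)) (RintegralZl _ measurableT (iF n))
      (RintegralD measurableT i1 i2)).
    apply: le_RintegralT.
    - exact: integrableZR (ikG Vw).
    - exact: integrableDR i1 i2.
    move=> z; have := dpow_tangent_le (G w z) (G u z) p1.
    move/(ler_wpM2l (ltW (k0 z))); rewrite -subr_ge0 => tan.
    rewrite -subr_ge0; apply: le_trans tan _.
    rewrite /F -/t -Gw (_ : G u z - G w z = - (t * G v z)); last by rewrite Gw; ring.
    by rewrite le_eqVlt; apply/orP; left; apply/eqP; ring.
  have arith (a b c a' b' x : R) : b' = b + t * c -> a' <= a + t * x ->
      a - b <= a' - b' -> c <= x.
    move=> -> a'x ab; rewrite -(ler_pM2l t0) -subr_ge0.
    have -> : t * x - t * c = (a + t * x - a') + (a' - (b + t * c) - (a - b)) by ring.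
    by rewrite addr_ge0// subr_ge0.
  exact: arith fw kw.
have cvgR : (fun n => \int[nu]_z F n z) @ \oo -->
    \int[nu]_z (kappa z * dpow p (G u z) * G v z).
  apply: Rintegral_dominated_cvg mF _ cvgF ig Fg; apply: measurable_funM => //.
  by apply: measurable_funM => //; exact: measurable_dpow.
by apply: (cvgr_to_ge cvgR); exact: nearW.
Qed.

(** The one-sided inequality is used for both v and -v. *)
Lemma weak_solution : exists2 u, V u & forall v, V v ->
  \int[nu]_z (kappa z * dpow p (G u z) * G v z) = \int[mu]_x (f x * v x).
Proof.
have [u Vu umin] := dirichlet_minimizer; exists u => // v Vv.
apply/eqP; rewrite eq_le (euler_lagrange_ge Vu umin Vv) andbT.
have Vnv := V_lin (-1) V0 Vv; have := euler_lagrange_ge Vu umin Vnv.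
have iG' := integrable_LfunM q1 qp
  (Lfun_bounded_mul q1 mk knorm (Lfun_dpow p1 pq (G_Lp Vu))) (G_Lp Vv).
have -> : \int[mu]_x (f x * (0 + -1 * v x)) = - \int[mu]_x (f x * v x).
  rewrite -[RHS]mulN1r -(RintegralZl _ measurableT (ifu Vv)).
  by apply: eq_Rintegral => x _; ring.
have -> : \int[nu]_z (kappa z * dpow p (G u z) *
      G (fun x => 0 + -1 * v x) z) =
    - \int[nu]_z (kappa z * dpow p (G u z) * G v z).
  rewrite -[RHS]mulN1r -(RintegralZl _ measurableT iG').
  by apply: eq_Rintegral => z _; rewrite G_lin G_const0; ring.
by rewrite lerN2.
Qed.

End weak_solution.

(** * Duality: the flux problem, its optimality system and uniqueness *)

Lemma Rintegral_vanish d (T : measurableType d) (R : realType)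
    (mu : {measure set T -> \bar R}) (D : set T) (f : T -> R) :
  (forall x, ~ D x -> f x = 0) -> \int[mu]_(x in D) f x = \int[mu]_x f x.
Proof.
move=> f0; rewrite Rintegral_mkcond; apply: eq_Rintegral => x _.
by rewrite patchE; case: ifPn => //; rewrite notin_setE => /f0.
Qed.

Section duality.
Context d1 d2 (T1 : measurableType d1) (T2 : measurableType d2) (R : realType).
Variables (mu : {measure set T1 -> \bar R}) (nu : {measure set T2 -> \bar R}).
Variables (p q : R) (p1 : 1 < p) (pq : p^-1 + q^-1 = 1).
Variables (Om : set T1) (D : set T2).
Variables (V : set (T1 -> R)) (G : (T1 -> R) -> T2 -> R).
Hypothesis V_Lp : forall u, V u -> Lp_on mu Om p%:E u.
Hypothesis G_Lp : forall u, V u -> Lp_on nu D p%:E (G u).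
Hypothesis V0 : V (fun=> 0).
Hypothesis V_lin : forall u v c, V u -> V v -> V (fun x => u x + c * v x).
Hypothesis G_lin : forall u v c z,
  G (fun x => u x + c * v x) z = G u z + c * G v z.
Hypothesis G_closed : forall (u_ : nat -> T1 -> R) u h, (forall k, V (u_ k)) ->
  u \in Lfun mu p%:E -> {ae mu, forall x, u_ ^~ x @ \oo --> u x} ->
  (forall x, (forall k, u_ k x = 0) -> u x = 0) ->
  h \in Lfun nu p%:E -> {ae nu, forall z, (fun k => G (u_ k) z) @ \oo --> h z} ->
  V u /\ {ae nu, forall z, G u z = h z}.
Variable K : R.
Hypothesis K_gt0 : 0 < K.
Hypothesis poincare : forall u, V u ->
  \int[mu]_x (`|u x| `^ p) <= K * \int[nu]_z (`|G u z| `^ p).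
Variables (kappa : T2 -> R) (kmin kmax : R).
Hypothesis mkappa : measurable_fun setT kappa.
Hypothesis kmin_gt0 : 0 < kmin.
Hypothesis kmin_le : kmin <= kmax.
Hypothesis kappa_bounds :
  {ae nu, forall z, D z -> kmin <= kappa z <= kmax}.

(** This and the next three definitions unfold, for the nonlocal operators, to [is_nonlocal_div],
    [energy], [is_optimal] and [optimality_conditions], so the results below transfer by
    conversion. *)
Definition adjoint_graph (sigma : T2 -> R) (g : T1 -> R) : Prop :=
  [/\ Lp_on nu D q%:E sigma, Lp_on mu Om q%:E g &
      forall u, V u -> pairing mu Om g u = - pairing nu D sigma (G u)].

Definition dual_energy (sigma : T2 -> R) : R :=
  q^-1 * \int[nu]_(z in D) (kappa z `^ (1 - q) * `|sigma z| `^ q).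

Definition dual_optimal (f : T1 -> R) (sigma : T2 -> R) : Prop :=
  adjoint_graph sigma f /\
  forall tau, adjoint_graph tau f -> dual_energy sigma <= dual_energy tau.

Definition dual_conditions (f : T1 -> R) (sigma : T2 -> R) (u : T1 -> R) : Prop :=
  (forall tau g, adjoint_graph tau g ->
     \int[nu]_(z in D)
       (kappa z `^ (1 - q) * `|sigma z| `^ (q - 2) * sigma z * tau z)
     - pairing mu Om g u = 0) /\
  adjoint_graph sigma f.

Let q1 : 1 < q. Proof. by have [] := conjugate_exponent p1 pq. Qed.
Let q0 : 0 < q. Proof. exact: lt_trans q1. Qed.
Let qp : q^-1 + p^-1 = 1. Proof. by rewrite addrC. Qed.

(* On [D] this modifies [kappa] on a null set only; outside [D] all integrands
   vanish. *)
Let kap z := Num.min kmax (Num.max kmin (kappa z)).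

Let mkap : measurable_fun setT kap.
Proof. by apply: measurable_minr => //; exact: measurable_maxr. Qed.

Let kap_bounds z : kmin <= kap z <= kmax.
Proof. by rewrite /kap le_min kmin_le le_max lexx ge_min lexx. Qed.

Let kap_gt0 z : 0 < kap z.
Proof. by have /andP[+ _] := kap_bounds z; exact: lt_le_trans. Qed.

Let kap_kappa : {ae nu, forall z, D z -> kap z = kappa z}.
Proof.
apply: filterS kappa_bounds => z + Dz => /(_ Dz) /andP[lo hi].
by rewrite /kap max_r// min_r.
Qed.

Let w z := kap z `^ (1 - q).

Let w_gt0 z : 0 < w z. Proof. exact: powR_gt0. Qed.

Let mw : measurable_fun setT w.
Proof. exact: (@measurableT_comp _ _ _ _ _ _ (@powR R ^~ (1 - q))). Qed.

(** Since 1 - q < 0, the lower bound on the conductivity bounds the weight from above. *)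
Let w_bound z : `|w z| <= kmin `^ (1 - q).
Proof.
rewrite gtr0_norm// /w -opprB !powRN lef_pV2 ?posrE ?powR_gt0//.
apply: ge0_ler_powR; rewrite ?nnegrE ?subr_ge0 ?(ltW q1) ?(ltW kmin_gt0)//.
  exact: ltW.
by have /andP[] := kap_bounds z.
Qed.

Let weight_integral (h : T2 -> R) :
  measurable_fun setT h -> (forall z, ~ D z -> h z = 0) ->
  \int[nu]_(z in D) (kappa z `^ (1 - q) * h z) = \int[nu]_z (w z * h z).
Proof.
move=> mh h0; rewrite Rintegral_vanish; last first.
  by move=> z /h0 ->; rewrite mulr0.
apply: ae_eq_Rintegral.
- apply: measurable_funM => //.
  exact: (@measurableT_comp _ _ _ _ _ _ (@powR R ^~ (1 - q))).
- exact: measurable_funM.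
- apply: filterS kap_kappa => z kz; have [Dz|/h0 ->] := pselect (D z).
    by rewrite /w kz.
  by rewrite !mulr0.
Qed.

Let dual_energyE sigma : Lp_on nu D q%:E sigma ->
  dual_energy sigma = q^-1 * \int[nu]_z (w z * `|sigma z| `^ q).
Proof.
move=> [sq s0]; rewrite /dual_energy weight_integral//.
  by apply: measurable_norm_powR; exact: Lfun_measurable q1 sq.
by move=> z /s0 ->; rewrite normr0 powR0// gt_eqF.
Qed.

Let dual_conditionsE sigma tau : Lp_on nu D q%:E sigma ->
  Lp_on nu D q%:E tau ->
  \int[nu]_(z in D)
    (kappa z `^ (1 - q) * `|sigma z| `^ (q - 2) * sigma z * tau z) =
  \int[nu]_z (w z * (dpow q (sigma z) * tau z)).
Proof.
move=> [sq s0] [tq t0]; rewrite -weight_integral; last 2 first.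
- apply: measurable_funM; last exact: Lfun_measurable q1 tq.
  by apply: measurable_dpow; exact: Lfun_measurable q1 sq.
- by move=> z /t0 ->; rewrite mulr0.
by apply: eq_Rintegral => z _; rewrite /dpow !mulrA.
Qed.

Let pairing_mu g u : Lp_on mu Om q%:E g ->
  pairing mu Om g u = \int[mu]_x (g x * u x).
Proof. by move=> [_ g0]; apply: Rintegral_vanish => x /g0 ->; rewrite mul0r. Qed.

Let pairing_nu s h : Lp_on nu D q%:E s ->
  pairing nu D s h = \int[nu]_z (s z * h z).
Proof. by move=> [_ s0]; apply: Rintegral_vanish => z /s0 ->; rewrite mul0r. Qed.

Let iw_pow s : Lp_on nu D q%:E s ->
  nu.-integrable setT (EFin \o (fun z => w z * `|s z| `^ q)).
Proof.
move=> [sq _]; apply: integrable_bounded_mul mw w_bound _.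
exact: Lfun_powR_integrable q1 sq.
Qed.

Let iw_dpow s t : Lp_on nu D q%:E s -> Lp_on nu D q%:E t ->
  nu.-integrable setT (EFin \o (fun z => w z * (dpow q (s z) * t z))).
Proof.
move=> [sq _] [tq _]; apply: integrable_bounded_mul mw w_bound _.
by apply: integrable_LfunM p1 pq _ tq; exact: Lfun_dpow q1 qp sq.
Qed.

Let Lp_on_sub d (T : measurableType d) (m : {measure set T -> \bar R})
    (A : set T) (r : R) s t : 1 < r -> Lp_on m A r%:E s -> Lp_on m A r%:E t ->
  Lp_on m A r%:E (fun x => s x - t x).
Proof.
move=> r1 [sr s0] [tr t0]; split; first exact: LfunB.
by move=> x Ax; rewrite s0// t0// subrr.
Qed.

(** Makes the difference of two competitors an admissible test in the optimality system. *)
Let adjoint_graph_sub s t f : adjoint_graph s f -> adjoint_graph t f ->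
  adjoint_graph (fun z => t z - s z) (fun x => f x - f x).
Proof.
move=> [sq fq sG] [tq _ tG].
have dq := Lp_on_sub q1 tq sq; have ffq := Lp_on_sub q1 fq fq.
split => // u Vu; have := sG _ Vu; rewrite tG// => /oppr_inj.
rewrite pairing_mu// !pairing_nu// => ts.
have -> : \int[mu]_x ((f x - f x) * u x) = 0.
  rewrite (_ : 0 = \int[mu]_x (cst 0 x : R)); last first.
    by rewrite Rintegral_cst// mul0r.
  by apply: eq_Rintegral => x _; rewrite subrr mul0r.
have Gu := (G_Lp Vu).1.
have is_ := integrable_LfunM q1 qp sq.1 Gu.
have it := integrable_LfunM q1 qp tq.1 Gu.
rewrite (_ : \int[nu]_z _ = \int[nu]_z (t z * G u z - s z * G u z)); last first.
  by apply: eq_Rintegral => z _; rewrite mulrBl.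
by rewrite (RintegralB measurableT it is_) ts subrr oppr0.
Qed.

(* Nonnegative, and zero only where [s = t], by strict convexity of [|.|^q]. *)
Let gap s t z := w z * (q^-1 * (`|t z| `^ q - `|s z| `^ q) -
                        dpow q (s z) * (t z - s z)).

Let gap_ge0 s t z : 0 <= gap s t z.
Proof. by rewrite mulr_ge0 ?(ltW (w_gt0 z))// subr_ge0 dpow_tangent_le. Qed.

Let gapE s t z : gap s t z = q^-1 * (w z * `|t z| `^ q) -
  q^-1 * (w z * `|s z| `^ q) - w z * (dpow q (s z) * (t z - s z)).
Proof. by rewrite /gap; ring. Qed.

Let igap s t : Lp_on nu D q%:E s -> Lp_on nu D q%:E t ->
  nu.-integrable setT (EFin \o gap s t).
Proof.
move=> sq tq; have -> : gap s t = (fun z => q^-1 * (w z * `|t z| `^ q) -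
    q^-1 * (w z * `|s z| `^ q) - w z * (dpow q (s z) * (t z - s z))).
  by apply/funext => z; exact: gapE.
apply: integrableBR; last exact: iw_dpow sq (Lp_on_sub q1 tq sq).
by apply: integrableBR; apply: integrableZR; exact: iw_pow.
Qed.

(** The first-order term of [gap] drops out: it is the optimality system tested with t - s, whose
    divergence f - f pairs to 0 with u. *)
Let gap_integral f s u t : dual_conditions f s u -> adjoint_graph t f ->
  \int[nu]_z gap s t z = dual_energy t - dual_energy s.
Proof.
move=> [su sf] tf; have [sq fq _] := sf; have [tq _ _] := tf.
have dq := Lp_on_sub q1 tq sq.
have := su _ _ (adjoint_graph_sub sf tf).
rewrite dual_conditionsE// pairing_mu; last exact: Lp_on_sub.
have -> : \int[mu]_x ((f x - f x) * u x) = 0.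
  rewrite (_ : 0 = \int[mu]_x (cst 0 x : R)); last first.
    by rewrite Rintegral_cst// mul0r.
  by apply: eq_Rintegral => x _; rewrite subrr mul0r.
rewrite subr0 => I0; rewrite !dual_energyE//.
have is_ := iw_pow sq; have it := iw_pow tq; have id := iw_dpow sq dq.
have iqs := integrableZR q^-1 is_; have iqt := integrableZR q^-1 it.
rewrite (_ : \int[nu]_z gap s t z = \int[nu]_z (q^-1 * (w z * `|t z| `^ q) -
    q^-1 * (w z * `|s z| `^ q) - w z * (dpow q (s z) * (t z - s z)))); last first.
  by apply: eq_Rintegral => z _; exact: gapE.
rewrite (RintegralB measurableT (integrableBR iqt iqs) id) I0 subr0.
rewrite (RintegralB measurableT iqt iqs).
by rewrite (RintegralZl _ measurableT it) (RintegralZl _ measurableT is_).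
Qed.

Lemma dual_conditions_optimal f s u : dual_conditions f s u -> dual_optimal f s.
Proof.
move=> su; split; first exact: su.2.
by move=> t tf; rewrite -subr_ge0 -(gap_integral su tf) Rintegral_ge0.
Qed.

(** Mutual minimality equates the two energies, so the nonnegative [gap] has integral 0 and vanishes
    a.e. *)
Lemma dual_optimal_unique f s u t : dual_conditions f s u -> dual_optimal f t ->
  {ae nu, forall z, t z = s z}.
Proof.
move=> su [tf topt]; have [_ sopt] := dual_conditions_optimal su.
have [sq _ _] := su.2; have [tq _ _] := tf.
have I0 : \int[nu]_z gap s t z = 0.
  rewrite (gap_integral su tf); apply/eqP; rewrite subr_eq0 eq_le.
  by rewrite topt ?sopt//; exact: su.2.
have := Rintegral_eq0_ae (igap sq tq) (gap_ge0 s t) I0.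
apply: filterS => z /eqP; rewrite mulf_eq0 gt_eqF//= subr_eq0 => /eqP E.
apply/eqP; apply: contra_eqT E => ts.
by rewrite gt_eqF// dpow_tangent_lt// eq_sym.
Qed.

(** Turns uniqueness into necessity: any optimal flux inherits the multiplier of the constructed
    one. *)
Lemma dual_conditions_ae f s u t : dual_conditions f s u -> adjoint_graph t f ->
  {ae nu, forall z, t z = s z} -> dual_conditions f t u.
Proof.
move=> [su sf] tf ts; split => // tau g tg; have [tq _ _] := tf.
have [sq _ _] := sf; have [tauq _ _] := tg.
rewrite -(su _ _ tg) !dual_conditionsE//; congr (_ - _).
apply: ae_eq_Rintegral.
- exact: integrable_measurable (iw_dpow tq tauq).
- exact: integrable_measurable (iw_dpow sq tauq).
- by apply: filterS ts => z ->.
Qed.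

Lemma dual_solution f : Lp_on mu Om q%:E f ->
  exists s u, V u /\ dual_conditions f s u.
Proof.
move=> fq; have V_Lp' u (Vu : V u) := (V_Lp Vu).1.
have G_Lp' u (Vu : V u) := (G_Lp Vu).1.
have [u Vu uP] := weak_solution p1 pq V_Lp' G_Lp' V0 V_lin G_lin G_closed K_gt0
  poincare mkap kmin_gt0 kap_bounds fq.1.
have kap_norm z : `|kap z| <= kmax.
  by have /andP[_] := kap_bounds z; rewrite gtr0_norm.
have zq : Lp_on nu D q%:E (fun z => kap z * dpow p (G u z)).
  split.
    exact: Lfun_bounded_mul q1 mkap kap_norm (Lfun_dpow p1 pq (G_Lp' _ Vu)).
  by move=> z /(G_Lp Vu).2 ->; rewrite dpow0 mulr0.
(* As [dpow] is odd, the minus sign of the flux can sit inside; [dpowK] then returns - G u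
   directly. *)
pose s z := kap z * dpow p (- G u z).
have sE z : s z = - (kap z * dpow p (G u z)).
  by rewrite /s /dpow normrN !mulrN.
have sq : Lp_on nu D q%:E s.
  have := Lp_on_sub q1 (Lp_on_sub q1 zq zq) zq.
  congr (Lp_on _ _ _ _); apply/funext => z.
  by rewrite subrr sub0r sE.
exists s, u; split => //; split; last first.
  split => // v Vv; rewrite pairing_mu// pairing_nu// -(uP _ Vv).
  have iv := integrable_LfunM q1 qp sq.1 (G_Lp' _ Vv).
  rewrite -mulN1r -(RintegralZl _ measurableT iv).
  by apply: eq_Rintegral => z _; rewrite sE; ring.
move=> tau g tg; have [tauq gq tG] := tg.
rewrite dual_conditionsE// tG// pairing_nu// opprK.
have iu := integrable_LfunM q1 qp tauq.1 (G_Lp' _ Vu).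
have iw := iw_dpow sq tauq.
rewrite -(RintegralD measurableT iw iu).
rewrite (_ : 0 = \int[nu]_z (cst 0 z : R)); last first.
  by rewrite Rintegral_cst// mul0r.
apply: eq_Rintegral => z _; rewrite mulrA /w /s dpowK//=; ring.
Qed.

Lemma dual_multiplier_unique f s u v : Lp_on mu Om p%:E u ->
  Lp_on mu Om p%:E v -> dual_conditions f s u -> dual_conditions f s v ->
  {ae mu, forall x, u x = v x}.
Proof.
move=> up vp [su _] [sv _]; have uvp := Lp_on_sub p1 up vp.
pose g x := dpow p (u x - v x).
have gq : Lp_on mu Om q%:E g.
  split; first exact: Lfun_dpow p1 pq uvp.1.
  by move=> x Ax; rewrite /g uvp.2// dpow0.
(* Solving the problem with right-hand side [g] exhibits [g] as the divergence of some [t], and both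
   systems are tested with that [t]. *)
have [t [_ [_ [_ tg]]]] := dual_solution gq.
have := su _ _ tg; rewrite -(sv _ _ tg) => /addrI /oppr_inj.
rewrite !pairing_mu// => /eqP; rewrite -subr_eq0.
have iu := integrable_LfunM q1 qp gq.1 up.1.
have iv := integrable_LfunM q1 qp gq.1 vp.1.
rewrite -(RintegralB measurableT iu iv) => /eqP I0.
have uv_pow := Lfun_powR_integrable p1 uvp.1.
have uv_ge0 x : 0 <= `|u x - v x| `^ p by exact: powR_ge0.
have := Rintegral_eq0_ae uv_pow uv_ge0.
rewrite (_ : \int[mu]_x _ = \int[mu]_x (g x * u x - g x * v x)); last first.
  by apply: eq_Rintegral => x _; rewrite -mulrBr dpowMr.
move=> /(_ I0); apply: filterS => x /powR_eq0_eq0 /normr0_eq0 /eqP.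
by rewrite subr_eq0 => /eqP.
Qed.

End duality.

(** * Measurability, linearity and closedness of the nonlocal gradient *)

Section nonlocal_operators.
Context {R : realType} {n : nat}.
Local Notation X := 'rV[R]_n.
Local Notation mu := (@lebesgue_rV R n).
Local Notation nu := (@lebesgue_rV2 R n).

Lemma measurable_subr_rV d (T : measurableType d) (f g : T -> X) :
  measurable_fun setT f -> measurable_fun setT g ->
  measurable_fun setT (fun t => f t - g t).
Proof.
move=> mf mg; apply: measurable_fun_rVP => i.
under eq_fun do rewrite !mxE.
by apply: measurable_funB; apply: measurableT_comp (measurable_coord i) _.
Qed.

Lemma measurable_eball (x : X) (r : R) : measurable (eball x r).
Proof.
have md : measurable_fun setT (fun y : X => enorm (y - x)).
  apply: measurableT_comp measurable_enorm _.
  apply: (@measurable_subr_rV _ _ id (cst x)); first exact: measurable_id.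
  exact: measurable_cst.
rewrite [X in measurable X](_ : _ = (fun y => enorm (y - x)) @^-1` `]-oo, r[).
  by rewrite -[X in measurable X]setTI; exact: md.
by apply/seteqP; split=> y; rewrite /eball /= in_itv.
Qed.

Lemma continuous_enorm_sub (y : X) : continuous (fun x : X => enorm (y - x)).
Proof.
move=> x; apply: (@continuous_cvg _ _ _ (nbhs x) _
  (fun x => dot (y - x) (y - x)) (@Num.sqrt R)); first exact: (@sqrt_continuous R).
have cvgi i : ((y - z) ord0 i) @[z --> x] --> (y - x) ord0 i.
  under eq_fun do rewrite !mxE.
  rewrite !mxE; apply: (@cvgB _ _ _ (nbhs x) _ (fun=> y ord0 i)
    (fun z : X => z ord0 i)); [exact: cvg_cst|exact: coord_continuous].
rewrite /dot; elim: (index_enum _) => [|i s IHs].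
  by under eq_fun do rewrite big_nil; rewrite big_nil; exact: cvg_cst.
under eq_fun do rewrite big_cons.
by rewrite big_cons; apply: cvgD IHs; apply: cvgM; exact: cvgi.
Qed.

(* [Omega] being open, its points with rational coordinates already provide
   all the balls. *)
Lemma measurable_delta_neighborhood (Omega : set X) (delta : R) :
  open Omega -> measurable (delta_neighborhood Omega delta).
Proof.
move=> oOmega; pose rat_pt (r : 'rV[rat]_n) : X := map_mx ratr r.
rewrite [X in measurable X](_ : _ = \bigcup_(r in [set: 'rV[rat]_n])
    (if rat_pt r \in Omega then eball (rat_pt r) delta else set0)).
  apply: countable_bigcupT_measurable; first exact: countableP.
  by move=> r; case: ifP => // _; exact: measurable_eball.
apply/seteqP; split=> [y [x Omx xy]|y [r _]]; last first.
  by case: ifPn => // /set_mem Omr yr; exists (rat_pt r).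
(* Being an admissible centre for y is an open condition, so a rational point near x serves as
   well. *)
have : \forall z \near x, Omega z /\ enorm (y - z) < delta.
  near=> z; split; near: z; first exact: open_nbhs_nbhs.
  by have /cvgr_lt := @continuous_enorm_sub y x; apply.
move=> /nbhs_ballP[e /= e0 xe].
(* Neighbourhoods here are balls of the sup norm, so the rational coordinates can be chosen
   independently. *)
have /choice[r rP] : forall i, exists r : rat, ratr r \in `]x ord0 i, x ord0 i + e[.
  by move=> i; apply: rat_in_itvoo; rewrite ltrDl.
have [] := xe (rat_pt (\row_i r i)).
  split => // i j; rewrite (ord1 i) !mxE /ball/= distrC.
  have := rP j; rewrite in_itv/= => /andP[lo hi].
  by rewrite ger0_norm ?subr_ge0 ?(ltW lo)// ltrBlDl.
by move=> Omr yr; exists (\row_i r i) => //; rewrite mem_set.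
Unshelve. all: by end_near. Qed.

(** The cylinder over a null set is null, even with an unbounded fibre, because 0 times infinity is
    0. *)
Lemma ae_fst (P : X -> Prop) :
  {ae mu, forall x, P x} -> {ae nu, forall z, P z.1}.
Proof.
move=> [N [mN N0 PN]]; exists (N `*` setT); split.
- exact: measurableX.
- transitivity (mu N * mu setT)%E; first exact: product_measure1E.
  by rewrite [X in (X * _)%E]N0 mul0e.
- by move=> z Pz; split => //; exact: PN.
Qed.

Lemma ae_snd (P : X -> Prop) :
  {ae mu, forall x, P x} -> {ae nu, forall z, P z.2}.
Proof.
move=> [N [mN N0 PN]]; exists (setT `*` N); split.
- exact: measurableX.
- transitivity (mu setT * mu N)%E; first exact: product_measure1E.
  by rewrite [X in (_ * X)%E]N0 mule0.
- by move=> z Pz; split => //; exact: PN.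
Qed.

Variables (p : R) (p1 : 1 < p) (Omega : set X) (delta : R) (omega : X -> R).
Hypothesis oOmega : open Omega.
Hypothesis momega : measurable_fun setT omega.
Local Notation V := (nonlocal_space p Omega delta omega).
Local Notation G := (nonlocal_grad Omega delta omega).

Let p0 : 0 < p. Proof. exact: lt_trans p1. Qed.

Lemma measurable_pair_domain : measurable (pair_domain Omega delta).
Proof. by apply: measurableX; exact: measurable_delta_neighborhood. Qed.

Lemma nonlocal_grad_lin (u v : X -> R) (c : R) z :
  G (fun x => u x + c * v x) z = G u z + c * G v z.
Proof.
by rewrite /nonlocal_grad !patchE; case: ifP => _; [ring|rewrite mulr0 addr0].
Qed.

Lemma measurable_nonlocal_grad (u : X -> R) :
  measurable_fun setT u -> measurable_fun setT (G u).
Proof.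
move=> mu_; apply/measurable_restrict => //; first exact: measurable_pair_domain.
rewrite setTI; apply: measurable_funTS; apply: measurable_funM.
  by apply: measurable_funB; exact: measurableT_comp.
by apply: measurableT_comp momega _; exact: measurable_subr_rV.
Qed.

Lemma nonlocal_space_lin u v c : V u -> V v -> V (fun x => u x + c * v x).
Proof.
move=> [[up u0] [Gup Gu0]] [[vp v0] [Gvp Gv0]]; split; split.
- exact: LfunDZ.
- by move=> x Ox; rewrite u0// v0// mulr0 addr0.
- have := LfunDZ c p1 Gup Gvp.
  by rewrite (_ : (fun z => _) = G (fun x => u x + c * v x))//;
    apply/funext => z; rewrite nonlocal_grad_lin.
- by move=> z Dz; rewrite nonlocal_grad_lin Gu0// Gv0// mulr0 addr0.
Qed.

Lemma nonlocal_space0 : V (fun=> 0).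
Proof.
have zero_p d (T : measurableType d) (m : {measure set T -> \bar R}) :
    (fun=> 0) \in Lfun m p%:E.
  apply/Lfun_powRP => //; split => //.
  by under [X in EFin \o X]eq_fun do rewrite normr0 powR0 ?gt_eqF//; exact: integrable0.
have G0 : G (fun=> 0) = fun=> 0.
  by apply/funext => z; rewrite /nonlocal_grad patchE subrr mul0r if_same.
by split; split => //; rewrite G0.
Qed.

(** Outside null cylinders [u_ k] converges at both z.1 and z.2, so the pointwise formula identifies
    the limit of the gradients with G u; integrability of |G u|^p is then inherited from [h]. *)
Lemma nonlocal_grad_closed (u_ : nat -> X -> R) u h : (forall k, V (u_ k)) ->
  u \in Lfun mu p%:E -> {ae mu, forall x, u_ ^~ x @ \oo --> u x} ->
  (forall x, (forall k, u_ k x = 0) -> u x = 0) ->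
  h \in Lfun nu p%:E -> {ae nu, forall z, (fun k => G (u_ k) z) @ \oo --> h z} ->
  V u /\ {ae nu, forall z, G u z = h z}.
Proof.
move=> Vu up uu u0 hp Gh.
have Guh : {ae nu, forall z, G u z = h z}.
  apply: filterS3 Gh (ae_fst uu) (ae_snd uu) => z Ghz u1 u2.
  apply: cvg_unique Ghz; first exact: norm_hausdorff.
  have GE v : G v z = if z \in pair_domain Omega delta
      then (v z.1 - v z.2) * omega (z.1 - z.2) else 0 by exact: patchE.
  have -> : (fun k => G (u_ k) z) = (fun k => if z \in pair_domain Omega delta
      then (u_ k z.1 - u_ k z.2) * omega (z.1 - z.2) else 0) by exact/funext.
  by rewrite GE; case: ifP => _; [apply: cvgMl; exact: cvgB|exact: cvg_cst].
split => //; split; split => //.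
- by move=> x Ox; apply: u0 => k; have [[_ ->]] := Vu k.
- apply/Lfun_powRP => //.
  have mGu := measurable_nonlocal_grad (Lfun_measurable p1 up); split => //.
  apply: integrable_ae_le (Lfun_powR_integrable p1 hp).
    exact: measurable_norm_powR.
  by apply: filterS Guh => z ->; rewrite ger0_norm ?powR_ge0.
- by move=> z Dz; rewrite /nonlocal_grad patchE memNset.
Qed.

Lemma nonlocal_poincare_integral C : 0 < C ->
  nonlocal_poincare p Omega delta omega C -> forall u, V u ->
  \int[mu]_x (`|u x| `^ p) <= C `^ p * \int[nu]_z (`|G u z| `^ p).
Proof.
move=> C0 poinc u Vu; have [[up _] [Gup _]] := Vu.
have pE d (T : measurableType d) (m : {measure set T -> \bar R}) (v : T -> R) :
    v \in Lfun m p%:E ->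
    ((Lnorm m p%:E (EFin \o v)) `^ p = (\int[m]_x (`|v x| `^ p))%:E)%E.
  move=> vp; rewrite poweR_Lnorm ?gt_eqF// /Rintegral fineK//.
  exact: (integrable_fin_num measurableT (Lfun_powR_integrable p1 vp)).
rewrite -lee_fin EFinM -!pE// -poweR_EFin -poweRM ?lee_fin ?(ltW C0)//.
apply: gt0_ler_poweR (poinc _ Vu); rewrite ?in_itv/= ?leey ?andbT ?(ltW p0)//.
- exact: Lnorm_ge0.
- by rewrite mule_ge0 ?Lnorm_ge0// lee_fin ltW.
- exact: Lnorm_ge0.
Qed.

End nonlocal_operators.

(** * The nonlocal problem as an instance of the abstract duality *)

Theorem theorem2p3 (R : realType) (n : nat) (p q : R)
    (Omega : set 'rV[R]_n) (e : 'rV[R]_n) (omega : R -> 'rV[R]_n -> R)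
    (delta_bar C kmin kmax delta : R) (A : set ('rV[R]_n * 'rV[R]_n -> R))
    (f : 'rV[R]_n -> R) (kappa : 'rV[R]_n * 'rV[R]_n -> R)
    (hn : (2 <= n)%N) (hp : 1 < p) (hpq : p^-1 + q^-1 = 1)
    (hOmega : bounded_lipschitz_domain Omega)
    (he : sphere e)
    (homega : forall d, 0 < d -> is_kernel p d (omega d) e)
    (hdelta_bar : 0 < delta_bar) (hC : 0 < C)
    (hpoincare : forall d, 0 < d -> d < delta_bar ->
       nonlocal_poincare p Omega d (omega d) C)
    (hkmin : 0 < kmin) (hkmax : kmin <= kmax)
    (hdelta : 0 < delta < delta_bar)
    (hA : admissible_conductivities Omega delta kmin kmax A)
    (hf : Lp_dom Omega q%:E f) (hkappa : A kappa) :
  let optimal := is_optimal p q Omega delta (omega delta) kappa f in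
  let conditions :=
    optimality_conditions p q Omega delta (omega delta) kappa f in
  (exists sigma_opt : 'rV[R]_n * 'rV[R]_n -> R,
    [/\ optimal sigma_opt,
        forall sigma, optimal sigma -> sigma = sigma_opt %[ae lebesgue_rV2 n] &
        exists u_opt : 'rV[R]_n -> R,
          [/\ Lp_dom Omega p%:E u_opt,
              conditions sigma_opt u_opt &
              forall u, Lp_dom Omega p%:E u -> conditions sigma_opt u ->
                u = u_opt %[ae lebesgue_rV n]]]) /\
  (forall sigma : 'rV[R]_n * 'rV[R]_n -> R,
    optimal sigma <->
    exists u : 'rV[R]_n -> R, Lp_dom Omega p%:E u /\ conditions sigma u).

Proof.
move=> optimal conditions.
have p0 : 0 < p by rewrite (lt_trans ltr01).
have [d0 d_bar] := andP hdelta.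
have [oOmega _ _ _] := hOmega.
have [momega _ _ _ _] := homega _ d0.
have [A_Loo _ _ _ A_bounds] := hA.
have mkappa : measurable_fun setT kappa.
  by have [/sub_Lfun_mfun + _] := A_Loo _ hkappa; rewrite inE.
have kappa_bounds : {ae lebesgue_rV2 n, forall z,
    pair_domain Omega delta z -> kmin <= kappa z <= kmax}.
  by apply: filterS (A_bounds _ hkappa) => z /[apply] -[].
pose V := nonlocal_space p Omega delta (omega delta).
pose G := nonlocal_grad Omega delta (omega delta).
have V_Lp u (Vu : V u) := Vu.1.
have G_Lp u (Vu : V u) := Vu.2.
have V0 : V (fun=> 0) by exact: nonlocal_space0.
have V_lin u v c (Vu : V u) (Vv : V v) := nonlocal_space_lin hp c Vu Vv.
have G_lin := nonlocal_grad_lin Omega delta (omega delta).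
have G_closed := nonlocal_grad_closed (delta := delta) hp oOmega momega.
have K0 : 0 < C `^ p by rewrite powR_gt0.
have poinc := nonlocal_poincare_integral hp hC (hpoincare _ d0 d_bar).
have [s [u [Vu su]]] := dual_solution hp hpq V_Lp G_Lp V0 V_lin G_lin G_closed
  K0 poinc mkappa hkmin hkmax kappa_bounds hf.
have unique t : optimal t -> {ae lebesgue_rV2 n, forall z, t z = s z} :=
  dual_optimal_unique hp hpq G_Lp mkappa hkmin hkmax kappa_bounds su.
have opt t v (tv : conditions t v) : optimal t :=
  dual_conditions_optimal hp hpq G_Lp mkappa hkmin hkmax kappa_bounds tv.
have cond_ae t (tf : is_nonlocal_div p q Omega delta (omega delta) t f)
    (ts : {ae lebesgue_rV2 n, forall z, t z = s z}) : conditions t u :=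
  dual_conditions_ae hp hpq mkappa hkmin hkmax kappa_bounds su tf ts.
split.
  exists s; split.
  - exact: opt su.
  - by move=> t /unique; apply: filterS => z ->.
  - exists u; split => //; first exact: V_Lp.
    move=> v vp sv; have := dual_multiplier_unique hp hpq V_Lp G_Lp V0 V_lin
      G_lin G_closed K0 poinc mkappa hkmin hkmax kappa_bounds vp (V_Lp _ Vu) sv su.
    by apply: filterS => z ->.
move=> t; split=> [topt|[v [_ tv]]]; last exact: opt tv.
(* Necessity: an optimal [t] equals [s] a.e., so the same [u] is a multiplier for it. *)
exists u; split; first exact: V_Lp.
exact: cond_ae topt.1 (unique _ topt).
Qed.
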